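(* Under the setup in the context (fixed, undirected, connected graph), assume additionally that all roots of $s^{n-1}+b_{n-1}s^{n-2}+\dots+b_2s+b_1=0$ lie strictly inside the unit circle. Then: (i) if $\beta>\frac{1}{2f_M}\big(\frac{\gamma\lambda_G^2}{\lambda_2^3}+\gamma\alpha\big)$, then $\lim_{t\to\infty}E\big[\|x_i(t)-\bar x(t)\|^2\big]=0$ for every $i=1,\dots,N$; (ii) if $\gamma>\frac1{\lambda_2}$ and $\beta>\frac{1}{2f_M}\big(\frac{\gamma^2\lambda_G^2}{\lambda_2^2(\gamma\lambda_2-1)}+\gamma\alpha+1\big)$, then $E\big[\|x_i(t)-\bar x(t)\|^2\big]=O(1/t)$ for every $i=1,\dots,N$.
   Context: Fix integers $n\ge 2$ and $N\ge 2$. Let $a_1,\dots,a_n\in\mathbb{R}$, let $A\in\mathbb{R}^{n\times n}$ be the matrix with $A_{k,k+1}=1$ for $k=1,\dots,n-1$, last row $(a_1,a_2,\dots,a_n)$, and all other entries $0$, and let $B=(0,\dots,0,1)^T\in\mathbb{R}^n$. There are $N$ agents with dynamics $x_i(t+1)=Ax_i(t)+Bu_i(t)$, $i=1,\dots,N$, where $x_i(t)=(x_{i1}(t),\dots,x_{in}(t))^T\in\mathbb{R}^n$ and $u_i(t)\in\mathbb{R}$; write $\bar x(t)=\frac1N\sum_{i=1}^N x_i(t)$. $\|\cdot\|$ is the Euclidean norm for vectors and spectral norm for matrices. Communication graph: $G$ is a fixed, undirected, connected graph on $\{1,\dots,N\}$; $N_i$ is the neighbor set of agent $i$, $d_i=|N_i|$,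 $d_{\max}=\max_i d_i$, and $L$ is the Laplacian of $G$ (degree matrix minus adjacency matrix), with eigenvalues $0=\lambda_1<\lambda_2\le\dots\le\lambda_N$. Gains: real numbers $b_1,\dots,b_{n-1}$ (compression coefficients), $K_2=[b_1,\dots,b_{n-1},1]\in\mathbb R^{1\times n}$, and $K_1=[-a_1+b_1,\,-a_2+b_2-b_1,\,\dots,\,-a_{n-1}+b_{n-1}-b_{n-2},\,-a_n-b_{n-1}+1]\in\mathbb R^{1\times n}$. Communication: for every ordered pair $(i,j)$ with $j\in N_i$ and every integer $t$, agent $i$ receives the bit $s_{ij}(t)=1$ if $K_2x_j(t)+d_{ij}(t)\le c_{ij}$ and $s_{ij}(t)=0$ otherwise, where $c_{ij}\in\mathbb R$ are fixed thresholds and the noises $\{d_{ij}(t)\}$ are i.i.d. $N(0,\sigma^2)$, $\sigma>0$, over all $i,j,t$; $F$ and $f$ denote the distribution function and density of $N(0,\sigma^2)$. Algorithm: fix $\beta>0$, $\gamma>0$, an integer $t_0>\gamma d_{\max}-1$, deterministic initial states $x_i(t_0+1)=x_i^0$ and deterministic initial estimates $\hat z_{ij}(t_0)=\hat z_{ij}^0$, and $M>0$ with $|K_2x_i^0|\le M$ and $|\hat z^0_{ij}|\le M$ for all $i$ and $j\in N_i$. Let $\Pi_M(\zeta)=\max\{-M,\min\{M,\zeta\}\}$ (projection onto $[-M,M]$). For $t\ge t_0+1$, for all $i$ and $j\in N_i$: $\hat z_{ij}(t)=\Pi_M\big(\hat z_{ij}(t-1)+\tfrac{\beta}{t}(F(c_{ij}-\hat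 z_{ij}(t-1))-s_{ij}(t))\big)$, and $u_i(t)=K_1x_i(t)+\frac{\gamma}{t+1}\sum_{j\in N_i}(\hat z_{ij}(t)-K_2x_i(t))$. Constants: enumerate the $d=\sum_i d_i$ ordered pairs $(i,j)$ with $j\in N_i$ as $p=1,\dots,d$. Let $W\in\mathbb R^{N\times d}$ with $W_{k,p}=1$ if pair $p$ has first component $k$ and $0$ otherwise; $Q\in\mathbb R^{d\times N}$ with $Q_{p,k}=1$ if pair $p$ has second component $k$ and $0$ otherwise; $J_N=I_N-\frac1N\mathbf 1_N\mathbf 1_N^T$. Set $\lambda_G=\|J_NW\|^2$, $\lambda_{QW}=\|QW\|^2$, $\lambda_{QL}=\|QL\|^2$, $\alpha=2\sqrt{\lambda_{QW}}+\lambda_{QL}\lambda_2/\lambda_G$, and $f_M=\min_{(i,j):\,j\in N_i} f(|c_{ij}|+M)$. $O(1/t)$ means bounded by $C/t$ for a constant $C$ and all $t\ge t_0+1$. *)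

(* Defs.v *)
From HB Require Import structures.
From mathcomp Require Import all_boot all_order all_algebra.
From mathcomp Require Import all_classical all_reals all_analysis.
From mathcomp Require Import complex.

Set Implicit Arguments.
Unset Strict Implicit.
Unset Printing Implicit Defensive.

Import Order.TTheory GRing.Theory Num.Theory.
Local Open Scope classical_set_scope.
Local Open Scope ring_scope.

Section Defs.
Variable R : realType.

Definition sqnorm (k : nat) (v : 'cV[R]_k) : R := \sum_(i < k) v i ord0 ^+ 2.

Definition opnorm2 (p q : nat) (M : 'M[R]_(p, q)) : R :=
  sup [set sqnorm (M *m v) | v in [set v : 'cV[R]_q | sqnorm v <= 1]].

Variable N : nat.
Variable adj : rel 'I_N.

Definition nbrs (i : 'I_N) : {set 'I_N} := [set j | adj i j].
Definition deg (i : 'I_N) : nat := #|nbrs i|.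
Definition dmax : nat := \max_(i < N) deg i.

Definition laplacian : 'M[R]_N :=
  \matrix_(i, j) ((deg i)%:R *+ (i == j) - (adj i j)%:R).

Definition pairs : {set 'I_N * 'I_N} := [set p | adj p.1 p.2].
Definition npairs : nat := #|pairs|.
Definition pair_of (p : 'I_npairs) : 'I_N * 'I_N := enum_val p.

Definition Wmx : 'M[R]_(N, npairs) :=
  \matrix_(k, p) ((pair_of p).1 == k)%:R.
Definition Qmx : 'M[R]_(npairs, N) :=
  \matrix_(p, k) ((pair_of p).2 == k)%:R.
Definition JN : 'M[R]_N := 1%:M - (N%:R)^-1 *: const_mx 1.

Definition lambdaG : R := opnorm2 (JN *m Wmx).
Definition lambdaQW : R := opnorm2 (Qmx *m Wmx).
Definition lambdaQL : R := opnorm2 (Qmx *m laplacian).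

Definition gaussF (sigma x : R) : R := fine (normal_prob 0 sigma `]-oo, x]).
Definition gaussf (sigma x : R) : R := normal_pdf 0 sigma x.

Variable n : nat.

Definition Amx (a : 'I_n -> R) : 'M[R]_n :=
  \matrix_(k, l) (if (k.+1 < n)%N then (l == k.+1 :> nat)%:R else a l).
Definition Bvec : 'cV[R]_n := \col_k (k.+1 == n)%:R.

(** b extended by b_0 = 0 and b_n = 1: bext m = b_m (1-based),
    b : 'I_n.-1 -> R with b j = b_{j+1}. *)
Definition bext (b : 'I_n.-1 -> R) (m : nat) : R :=
  if m == n then 1 else
  if m is m'.+1 then (if insub m' is Some j then b j else 0) else 0.

(** K2 = [b_1,...,b_{n-1},1],
    K1 = [-a_1+b_1, -a_2+b_2-b_1, ..., -a_{n-1}+b_{n-1}-b_{n-2}, -a_n-b_{n-1}+1] *)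
Definition K2 (b : 'I_n.-1 -> R) : 'rV[R]_n := \row_k bext b k.+1.
Definition K1 (a : 'I_n -> R) (b : 'I_n.-1 -> R) : 'rV[R]_n :=
  \row_k (- a k + bext b k.+1 - bext b k).

Definition sc (m : 'M[R]_1) : R := m ord0 ord0.

Definition bpoly (b : 'I_n.-1 -> R) : {poly R} :=
  'X^(n.-1) + \sum_(j < n.-1) b j *: 'X^j.

Definition projM (M z : R) : R := Num.max (- M) (Num.min M z).

(** One step of the closed loop at time t.  Input: x(t) and zhat(t-1),
    and the noise values d_ij(t).  Output: x(t+1) and zhat(t). *)
Definition step (a : 'I_n -> R) (b : 'I_n.-1 -> R) (c : 'I_N -> 'I_N -> R)
  (sigma beta gamma M : R) (t : nat)
  (st : ('I_N -> 'cV[R]_n) * ('I_N -> 'I_N -> R)) (dv : 'I_N -> 'I_N -> R)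
  : ('I_N -> 'cV[R]_n) * ('I_N -> 'I_N -> R) :=
  let X := st.1 in let Z := st.2 in
  let s i j : R := if sc (K2 b *m X j) + dv i j <= c i j then 1 else 0 in
  let Z' i j := if adj i j then
      projM M (Z i j + beta / t%:R * (gaussF sigma (c i j - Z i j) - s i j))
    else Z i j in
  let u i := sc (K1 a b *m X i)
      + gamma / (t.+1)%:R * \sum_(j in nbrs i) (Z' i j - sc (K2 b *m X i)) in
  (fun i => Amx a *m X i + u i *: Bvec, Z').

(** traj k w = (x(t0+1+k), zhat(t0+k)) for the noise realization w. *)
Fixpoint traj (T : Type) (a : 'I_n -> R) (b : 'I_n.-1 -> R) (c : 'I_N -> 'I_N -> R)
  (sigma beta gamma M : R) (t0 : nat)
  (x0 : 'I_N -> 'cV[R]_n) (z0 : 'I_N -> 'I_N -> R)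
  (d : 'I_N -> 'I_N -> nat -> T -> R) (k : nat) (w : T)
  : ('I_N -> 'cV[R]_n) * ('I_N -> 'I_N -> R) :=
  match k with
  | 0 => (x0, z0)
  | k'.+1 => step a b c sigma beta gamma M (t0 + k').+1
               (traj a b c sigma beta gamma M t0 x0 z0 d k' w)
               (fun i j => d i j (t0 + k').+1 w)
  end.

Definition xbar (X : 'I_N -> 'cV[R]_n) : 'cV[R]_n := (N%:R)^-1 *: \sum_i X i.

End Defs.

Definition mutually_independent {R : realType} {dT : measure_display}
  {T : measurableType dT} (P : probability T R) {I : eqType} (J : set I)
  (X : I -> T -> R) : Prop :=
  forall (S : seq I) (B : I -> set R),
    uniq S -> (forall i, i \in S -> J i) -> (forall i, measurable (B i)) ->
    P [set w | forall i, i \in S -> B i (X i w)] =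
    (\prod_(i <- S) P (X i @^-1` B i))%E.

(* Main.v *)
Require Import Defs.
From HB Require Import structures.
From mathcomp Require Import all_boot all_order all_algebra.
From mathcomp Require Import all_classical all_reals all_analysis.
From mathcomp Require Import complex.
From mathcomp Require Import measurable_realfun spectral.
From mathcomp Require Import ring lra.
Set Implicit Arguments.
Unset Strict Implicit.
Unset Printing Implicit Defensive.
Import Order.TTheory GRing.Theory Num.Theory.
Import numFieldNormedType.Exports.
Local Open Scope classical_set_scope.
Local Open Scope ring_scope.

(** A trajectory up to time t depends on the noise only through the finitely
many received bits, so every expectation is a finite sum, and independence
makes the state a Markov chain whose next bits are independent Bernoulli
variables with parameters F(c_ij - K_2 x_j).

The outputs z_i = K_2 x_i obey z(t+1) = z + gamma/(t+1) (W e - L z), where e is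
the estimation error of the z_j.  With V = |J z|^2 and E = |e|^2, one step gives
up to O(1/t^2) the linear system
  V' <= (1 - gamma lambda_2 / t) V + (gamma lambda_G / (lambda_2 t)) E,
  E' <= (1 - (2 beta f_M - gamma alpha) / t) E + (gamma lambda_G / (lambda_2 t)) V,
and the assumptions on beta are exactly what makes some positive combination
U = u V + v E satisfy U' <= (1 - rho/t) U + C/t^2 with rho > 0 (resp. rho > 1).

Finally the state is recovered from the output: factoring
s^(n-1) + b_(n-1) s^(n-2) + ... + b_1 over the complex numbers exhibits it as a
cascade of stable first-order filters, which preserve both convergence to 0 and
O(1/t). *)

(** * Inner products and operator norms *)

(** The estimation target moves: between two updates of an estimate, the output it tracks changes
    too. Each step is therefore split at the intermediate error, new estimates against old outputs.
    Passing to it is random and contracts in mean; what follows is deterministic and linear, so only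
    its mean square enters. The two couplings between V and E are made equal by the Young weights.
    Half of the dissipation 2 lambda_2 V pays for the error input, at the price lambda_G / lambda_2;
    the weight in the E-inequality is chosen to give V the same coefficient, which produces the
    summand lambda_QL lambda_2 / lambda_G of alpha. The resulting matrix, with diagonal p = gamma
    lambda_2 - theta, r = 2 beta f_M - gamma alpha - theta and off-diagonal -q, q = gamma lambda_G /
    lambda_2, is symmetric, and q^2 < p r is the hypothesis on beta, for theta = 0 in (i) and theta
    = 1 in (ii). The remainder is a deterministic O(1/t^2) since outputs and estimates stay in
    [-M, M]: the projection confines the estimates, and t_0 > gamma d_max - 1 makes each new output
    a convex combination of the old output and estimates. *)

Definition dot {R : realType} (k : nat) (u v : 'cV[R]_k) : R :=
  \sum_(i < k) u i ord0 * v i ord0.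

Section InnerProduct.
Variable R : realType.

Lemma sqnormE k (v : 'cV[R]_k) : sqnorm v = dot v v.
Proof. by apply: eq_bigr => i _; rewrite expr2. Qed.

Lemma sqnorm_ge0 k (v : 'cV[R]_k) : 0 <= sqnorm v.
Proof. by apply: sumr_ge0 => i _; exact: sqr_ge0. Qed.

Lemma sqr_le_sqnorm k (v : 'cV[R]_k) i : v i ord0 ^+ 2 <= sqnorm v.
Proof.
rewrite /sqnorm (bigD1 i) //= lerDl.
by apply: sumr_ge0 => j _; exact: sqr_ge0.
Qed.

Lemma sqnorm_eq0 k (v : 'cV[R]_k) : sqnorm v <= 0 -> v = 0.
Proof.
move=> v0; apply/matrixP => i j; rewrite (ord1 j) mxE; apply/eqP.
rewrite -sqrf_eq0 eq_le sqr_ge0 andbT.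
exact: le_trans (sqr_le_sqnorm v i) v0.
Qed.

Lemma dotC k (u v : 'cV[R]_k) : dot u v = dot v u.
Proof. by apply: eq_bigr => i _; rewrite mulrC. Qed.

Lemma dotDl k (u v w : 'cV[R]_k) : dot (u + v) w = dot u w + dot v w.
Proof. by rewrite -big_split; apply: eq_bigr => i _; rewrite mxE mulrDl. Qed.

Lemma dotZl k (c : R) (u v : 'cV[R]_k) : dot (c *: u) v = c * dot u v.
Proof. by rewrite mulr_sumr; apply: eq_bigr => i _; rewrite mxE mulrA. Qed.

Lemma dotDr k (u v w : 'cV[R]_k) : dot u (v + w) = dot u v + dot u w.
Proof. by rewrite dotC dotDl !(dotC u). Qed.

Lemma dotZr k (c : R) (u v : 'cV[R]_k) : dot u (c *: v) = c * dot u v.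
Proof. by rewrite dotC dotZl dotC. Qed.

Lemma dotNr k (u v : 'cV[R]_k) : dot u (- v) = - dot u v.
Proof. by rewrite -scaleN1r dotZr mulN1r. Qed.

Lemma dotBr k (u v w : 'cV[R]_k) : dot u (v - w) = dot u v - dot u w.
Proof. by rewrite dotDr dotNr. Qed.

Lemma dot0r k (u : 'cV[R]_k) : dot u 0 = 0.
Proof. by apply: big1 => i _; rewrite mxE mulr0. Qed.

Lemma sqnormD k (u v : 'cV[R]_k) :
  sqnorm (u + v) = sqnorm u + 2 * dot u v + sqnorm v.
Proof. by rewrite !sqnormE !(dotDl, dotDr) (dotC v u); ring. Qed.

Lemma sqnormZ k (c : R) (u : 'cV[R]_k) : sqnorm (c *: u) = c ^+ 2 * sqnorm u.
Proof. by rewrite !sqnormE dotZl dotZr mulrA expr2. Qed.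

Lemma sqnormN k (u : 'cV[R]_k) : sqnorm (- u) = sqnorm u.
Proof. by rewrite -scaleN1r sqnormZ sqrrN expr1n mul1r. Qed.

Lemma young_dot k (x : R) (u v : 'cV[R]_k) : 0 < x ->
  2 * dot u v <= x * sqnorm u + x^-1 * sqnorm v.
Proof.
move=> x0; have := sqnorm_ge0 (x *: u + (-1) *: v).
rewrite sqnormD dotZl dotZr !sqnormZ => h.
have xV : 0 < x^-1 by rewrite invr_gt0.
have e : x^-1 * x = 1 by rewrite mulVf ?gt_eqF.
have /(ler_wpM2l (ltW xV)) := h; rewrite mulr0.
have -> : x^-1 * (x ^+ 2 * sqnorm u + 2 * (x * (-1 * dot u v)) + (-1) ^+ 2 * sqnorm v)
  = (x^-1 * x) * x * sqnorm u - 2 * (x^-1 * x) * dot u v + x^-1 * sqnorm v by ring.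
by rewrite e; lra.
Qed.

(** The Young weight is [l * x], so that [l] cancels in front of [a] and [x] stays free for tuning.
    At [l = 0] this weight degenerates, but then [v] vanishes. *)
Lemma young_dot_bound k (l x a : R) (u v : 'cV[R]_k) : 0 <= l -> 0 < x ->
  0 <= a -> sqnorm v <= l * a ->
  2 * dot u v <= l * x * sqnorm u + x^-1 * a.
Proof.
rewrite le_eqVlt => /orP[/eqP <-|l0] x0 a0 h.
  rewrite mul0r in h; rewrite (sqnorm_eq0 h) dot0r !mul0r mulr0 add0r.
  by rewrite mulr_ge0 // invr_ge0 ltW.
apply: le_trans (young_dot u v (mulr_gt0 l0 x0)) _.
rewrite lerD2l invfM mulrC mulrA.
have -> : x^-1 * a = l * a * l^-1 / x by field; rewrite !gt_eqF.
by rewrite !ler_wpM2r // invr_ge0 ltW.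
Qed.

Lemma sqnormD_le2 k (u v : 'cV[R]_k) :
  sqnorm (u + v) <= 2 * sqnorm u + 2 * sqnorm v.
Proof. by rewrite sqnormD; have := young_dot u v (ltr01 : 0 < 1 :> R); rewrite invr1; lra. Qed.

(** A crude bound, whose only purpose is to show that the set under the supremum in [opnorm2] is
    bounded. *)
Lemma sqnorm_mulmx_frobenius p q (M : 'M[R]_(p, q)) (v : 'cV[R]_q) :
  sqnorm (M *m v) <= (\sum_(i < p) q%:R * \sum_(j < q) M i j ^+ 2) * sqnorm v.
Proof.
rewrite mulr_suml; apply: ler_sum => i _; rewrite mxE.
have sq (I : finType) (F : I -> R) :
    (\sum_i F i) ^+ 2 <= #|I|%:R * \sum_i F i ^+ 2.
  rewrite expr2 mulr_suml.
  have -> : \sum_i F i * (\sum_j F j) = \sum_i \sum_j F i * F j.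
    by apply: eq_bigr => ? _; rewrite mulr_sumr.
  apply: le_trans (_ : \sum_i \sum_j (F i ^+ 2 + F j ^+ 2) / 2 <= _).
    by apply: ler_sum => x _; apply: ler_sum => y _; have := sqr_ge0 (F x - F y); nra.
  under eq_bigr => x _ do rewrite -mulr_suml big_split /= sumr_const.
  rewrite -mulr_suml big_split /= sumr_const sumrMnl.
  by rewrite mulr_natl; set S := _ *+ _; lra.
apply: le_trans (sq _ _) _; rewrite card_ord -mulrA ler_wpM2l //.
rewrite mulr_suml; apply: ler_sum => j _.
by rewrite exprMn ler_wpM2l ?sqr_ge0 // sqr_le_sqnorm.
Qed.

Lemma opnorm2_has_sup p q (M : 'M[R]_(p, q)) :
  has_sup [set sqnorm (M *m v) | v in [set v : 'cV[R]_q | sqnorm v <= 1]].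
Proof.
split.
  exists 0, 0 => /=; last by rewrite mulmx0 sqnormE dot0r.
  by rewrite sqnormE dot0r.
exists (\sum_(i < p) q%:R * \sum_(j < q) M i j ^+ 2) => _ [v /= v1 <-].
apply: le_trans (sqnorm_mulmx_frobenius _ _) _.
rewrite -[leRHS]mulr1 ler_wpM2l //; apply: sumr_ge0 => i _.
by rewrite mulr_ge0 //; apply: sumr_ge0 => j _; rewrite sqr_ge0.
Qed.

Lemma opnorm2_ge p q (M : 'M[R]_(p, q)) v : sqnorm v <= 1 -> sqnorm (M *m v) <= opnorm2 M.
Proof. by move=> v1; apply: (ub_le_sup (opnorm2_has_sup M).2); exists v. Qed.

Lemma opnorm2_ge0 p q (M : 'M[R]_(p, q)) : 0 <= opnorm2 M.
Proof.
apply: le_trans (sqnorm_ge0 (M *m 0)) _.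
by apply: opnorm2_ge; rewrite sqnormE dot0r.
Qed.

(** By homogeneity, after rescaling [v] to the unit sphere. [opnorm2] is already the square of the
    spectral norm, hence no square on the right. *)
Lemma sqnorm_mulmx_le p q (M : 'M[R]_(p, q)) (v : 'cV[R]_q) :
  sqnorm (M *m v) <= opnorm2 M * sqnorm v.
Proof.
have [v0|v0] := leP (sqnorm v) 0.
  by rewrite (sqnorm_eq0 v0) mulmx0 !sqnormE !dot0r mulr0.
set r := Num.sqrt (sqnorm v).
have r0 : 0 < r by rewrite sqrtr_gt0.
have rE : r ^+ 2 = sqnorm v by rewrite sqr_sqrtr // ltW.
have -> : sqnorm (M *m v) = sqnorm (M *m (r^-1 *: v)) * sqnorm v.
  rewrite -scalemxAr sqnormZ exprVn rE mulrAC mulVf ?mul1r //.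
  by rewrite gt_eqF.
rewrite ler_wpM2r ?sqnorm_ge0 //; apply: opnorm2_ge.
by rewrite sqnormZ exprVn rE mulVf ?gt_eqF.
Qed.

End InnerProduct.

(** * The spectral gap of the Laplacian *)

Section Spectral.
Variable R : realType.
Local Notation toC := (real_complex R).

(** Unique factorization; it matches the given list of eigenvalues with the diagonal produced by the
    spectral theorem, multiplicities included. *)
Lemma prod_XsubC_perm_eq (F : fieldType) (s1 s2 : seq F) :
  \prod_(x <- s1) ('X - x%:P) = \prod_(x <- s2) ('X - x%:P) -> perm_eq s1 s2.
Proof.
elim: s1 s2 => [|x s1 IH] s2 e.
  have := congr1 (fun p : {poly F} => size p) e.
  by rewrite !size_prod_XsubC => -[] /esym/size0nil ->.
have xs2 : x \in s2.
  by rewrite -root_prod_XsubC -e root_prod_XsubC mem_head.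
rewrite perm_sym; apply: perm_trans (perm_to_rem xs2) _; rewrite perm_cons perm_sym.
apply: IH; move: e; rewrite (perm_big _ (perm_to_rem xs2)) !big_cons /=.
by apply: mulfI; rewrite polyXsubC_eq0.
Qed.

Lemma char_poly_similar (F : comUnitRingType) n (P A : 'M[F]_n) :
  P \in unitmx -> char_poly (invmx P *m A *m P) = char_poly A.
Proof.
move=> Pu; rewrite /char_poly /char_poly_mx.
set Q := map_mx polyC P; set Q' := map_mx polyC (invmx P).
have QQ : Q' *m Q = 1%:M by rewrite -map_mxM mulVmx // map_mx1.
have -> : 'X%:M - map_mx polyC (invmx P *m A *m P) =
   Q' *m ('X%:M - map_mx polyC A) *m Q.
  by rewrite !map_mxM mulmxBr mulmxBl scalar_mxC -(mulmxA _ Q' Q) QQ mulmx1.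
rewrite !det_mulmx mulrAC -det_mulmx QQ det1 mul1r //.
Qed.

Local Open Scope sesquilinear_scope.

(** Over [R[i]] the matrix is Hermitian, hence unitarily diagonalizable with real eigenvalues. The
    basis [P] stays complex, but the factorization of the characteristic polynomial descends to [R]
    because the embedding of polynomials is injective. *)
Lemma real_symmetric_spectral n (A : 'M[R]_n) : A^T = A ->
  exists (P : 'M[R[i]]_n) (mu : 'I_n -> R),
    [/\ P^t* *m P = 1%:M, P *m P^t* = 1%:M,
        map_mx toC A = P^t* *m diag_mx (\row_j toC (mu j)) *m P
      & char_poly A = \prod_(x <- [seq mu j | j <- enum 'I_n]) ('X - x%:P)].
Proof.
move=> Asym; set B := map_mx toC A.
have Bh : B \is hermsymmx.
  apply: realsym_hermsym.
    apply/is_hermitianmxP; rewrite expr0 scale1r map_mx_id //.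
    by apply/matrixP => i j; rewrite !mxE -[in LHS]Asym mxE.
  by apply/mxOverP => i j; rewrite mxE complex_real.
have Bn := hermitian_normalmx Bh.
have /orthomx_spectralP eB := Bn.
have /mxOverP Dr := hermitian_spectral_diag_real Bh.
set P := spectralmx B in eB; set D := spectral_diag B in eB Dr.
have Pu : P \is unitarymx by exact: spectral_unitarymx.
have PU : P \in unitmx by exact: spectral_unit.
exists P, (fun j => complex.Re (D 0 j)).
have DE : \row_j toC (complex.Re (D 0 j)) = D.
  by apply/rowP => j; rewrite mxE RRe_real.
rewrite -invmx_unitary // mulVmx // mulmxV // DE; split => //.
apply: (map_poly_inj toC); rewrite map_char_poly -/B eB char_poly_similar //.
rewrite char_poly_trig ?diag_mx_is_trig //.
rewrite rmorph_prod big_map big_enum /=; apply: eq_bigr => j _.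
by rewrite mxE eqxx mulr1n rmorphB /= map_polyX map_polyC /= RRe_real.
Qed.

End Spectral.

(** * The Laplacian of a connected graph *)

Section Laplacian.
Variables (R : realType) (N : nat) (adj : rel 'I_N).
Hypotheses (adj_sym : symmetric adj) (adj_conn : forall i j : 'I_N, connect adj i j).
Local Notation L := (laplacian R adj).
Local Notation toC := (real_complex R).

Lemma laplacian_mulE (v : 'cV[R]_N) i :
  (L *m v) i ord0 = \sum_(j | adj i j) (v i ord0 - v j ord0).
Proof.
rewrite mxE; under eq_bigr => j _ do rewrite mxE mulrBl.
rewrite !sumrB; congr (_ - _).
  rewrite (bigD1 i) //= eqxx big1 ?addr0; last first.
    by move=> j /negPf ji; rewrite eq_sym ji mul0r.
  by rewrite sumr_const -[RHS]mulr_natl /deg /nbrs cardsE.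
rewrite [RHS]big_mkcond; apply: eq_bigr => j _.
by case: (adj i j); rewrite ?mul1r ?mul0r.
Qed.

Lemma laplacian_tr : L^T = L.
Proof.
apply/matrixP => i j; rewrite !mxE adj_sym; congr (_ - _).
by rewrite eq_sym; case: eqP => // ->.
Qed.

(** The Dirichlet form of the graph; the factor 2 appears because each edge is summed in both
    orientations, and swapping them symmetrizes the sum. *)
Lemma dot_laplacian (v : 'cV[R]_N) :
  2 * dot v (L *m v) = \sum_i \sum_(j | adj i j) (v i ord0 - v j ord0) ^+ 2.
Proof.
have -> : dot v (L *m v) =
    \sum_i \sum_(j | adj i j) v i ord0 * (v i ord0 - v j ord0).
  by apply: eq_bigr => i _; rewrite laplacian_mulE mulr_sumr.
have sw : \sum_i \sum_(j | adj i j) v i ord0 * (v i ord0 - v j ord0) =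
    \sum_i \sum_(j | adj i j) v j ord0 * (v j ord0 - v i ord0).
  rewrite (exchange_big_dep xpredT) //=; apply: eq_bigr => i _.
  by apply: eq_bigl => j; rewrite adj_sym.
rewrite mulr2n mulrDl mul1r {2}sw -big_split /=; apply: eq_bigr => i _.
by rewrite -big_split /=; apply: eq_bigr => j _; ring.
Qed.

Lemma dot_laplacian_le0 (v : 'cV[R]_N) :
  dot v (L *m v) <= 0 -> forall i j, v i ord0 = v j ord0.
Proof.
move=> h.
have adjE i j : adj i j -> v i ord0 = v j ord0.
  move=> ij; apply/eqP; rewrite -subr_eq0 -sqrf_eq0 eq_le sqr_ge0 andbT.
  apply: le_trans (_ : 2 * dot v (L *m v) <= 0); last by lra.
  rewrite dot_laplacian (bigD1 i) //= (bigD1 j) //= -addrA lerDl addr_ge0 //.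
    by apply: sumr_ge0 => ? _; rewrite sqr_ge0.
  by apply: sumr_ge0 => ? _; apply: sumr_ge0 => ? _; rewrite sqr_ge0.
move=> i j; have /connectP[p] := adj_conn i j.
elim: p i => [i _ -> //|k p IH i /= /andP[ik kp] e].
by rewrite (adjE i k) //; exact: IH.
Qed.

Lemma laplacian_const (c : R) : L *m const_mx c = 0 :> 'cV_N.
Proof.
apply/matrixP => i j; rewrite (ord1 j) laplacian_mulE [RHS]mxE big1 // => k _.
by rewrite !mxE subrr.
Qed.

Local Open Scope sesquilinear_scope.

(** Eigenvectors with eigenvalue at most 0 are constant, so there cannot be two orthogonal ones and
    the second eigenvalue is positive. A vector of sum 0 has no component along the lowest
    eigenvector, and all other coordinates carry at least the second eigenvalue. *)
Lemma laplacian_spectral_gap (lam : seq R) : (2 <= N)%N ->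
  size lam = N -> sorted <=%R lam ->
  char_poly L = \prod_(x <- lam) ('X - x%:P) ->
  0 < lam`_1 /\
  forall v : 'cV[R]_N, \sum_i v i ord0 = 0 ->
    lam`_1 * sqnorm v <= dot v (L *m v).
Proof.
move=> hN lam_size lam_sorted lamE.
have [P [mu [PP PP' eL cL]]] := real_symmetric_spectral laplacian_tr.
have pe : perm_eq [seq mu j | j <- enum 'I_N] lam.
  by apply: prod_XsubC_perm_eq; rewrite -cL.
(* [Is] sends a diagonal position to its rank in the sorted list [lam]; [j0] and [j1] below are the
   positions of ranks 0 and 1. *)
have /(perm_iotaP 0)[Is pI eI] := pe.
have szI : size Is = N by rewrite (perm_size pI) size_iota.
have uI : uniq Is by rewrite (perm_uniq pI) iota_uniq.
have muE (j : 'I_N) : mu j = lam`_(nth 0%N Is j).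
  have := congr1 (fun s => nth 0 s j) eI.
  rewrite (nth_map j) ?size_enum_ord // nth_ord_enum => ->.
  by rewrite (nth_map 0%N) ?szI.
have exj k : (k < N)%N -> exists j : 'I_N, nth 0%N Is j = k.
  move=> kN; have kI : k \in Is by rewrite (perm_mem pI) mem_iota add0n lam_size kN.
  have lt : (index k Is < N)%N by rewrite -szI index_mem.
  by exists (Ordinal lt); rewrite /= nth_index.
have [j0 Ij0] := exj 0%N (ltnW hN); have [j1 Ij1] := exj 1%N hN.
have j01 : j0 != j1 by apply/eqP => e; move: Ij0; rewrite e Ij1.
have lam_mono k l : (k <= l)%N -> (l < N)%N -> lam`_k <= lam`_l.
  move=> kl lN; apply: (sorted_leq_nth le_trans le_refl 0 lam_sorted) => //.
    by rewrite inE lam_size (leq_ltn_trans kl).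
  by rewrite inE lam_size.
have mu_ge j : j != j0 -> lam`_1 <= mu j.
  move=> jj0; rewrite muE; apply: lam_mono.
    rewrite lt0n; apply/eqP => e; case/eqP: jj0; apply/val_inj/eqP.
    by rewrite -(nth_uniq 0%N _ _ uI) ?szI //= e Ij0.
  have : nth 0%N Is j \in iota 0 (size lam) by rewrite -(perm_mem pI) mem_nth ?szI.
  by rewrite mem_iota add0n lam_size.
(* The eigenvector is complex while the Dirichlet form is real: its real and imaginary parts are
   each eigenvectors of [L] for the same real eigenvalue, hence each constant. *)
have cst j : mu j <= 0 -> exists c, P^t* *m delta_mx j ord0 = const_mx c :> 'cV_N.
  move=> muj; set v := P^t* *m delta_mx j ord0.
  have ev : map_mx toC L *m v = toC (mu j) *: v.
    rewrite eL /v !mulmxA -(mulmxA _ P) PP' mulmx1 -mulmxA scalemxAr; congr (_ *m _).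
    apply/matrixP => k l; rewrite (ord1 l) mul_diag_mx !mxE eqxx andbT.
    by case: eqP => [->|]; rewrite ?mulr0.
  clearbody v.
  have ReM k : (L *m map_mx (@complex.Re R) v) k ord0 = complex.Re ((map_mx toC L *m v) k ord0).
    rewrite !mxE raddf_sum; apply: eq_bigr => l _; rewrite !mxE.
    by case: (v l ord0) => x y /=; rewrite mul0r subr0.
  have ImM k : (L *m map_mx (@complex.Im R) v) k ord0 = complex.Im ((map_mx toC L *m v) k ord0).
    rewrite !mxE raddf_sum; apply: eq_bigr => l _; rewrite !mxE.
    by case: (v l ord0) => x y /=; rewrite mul0r addr0.
  have rc (w : 'cV[R]_N) : L *m w = mu j *: w -> forall k l, w k ord0 = w l ord0.
    move=> e; apply: dot_laplacian_le0; rewrite e dotZr -sqnormE.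
    by rewrite mulr_le0_ge0 // sqnorm_ge0.
  have eRe : L *m map_mx (@complex.Re R) v = mu j *: map_mx (@complex.Re R) v.
    apply/matrixP => k l; rewrite (ord1 l) ReM ev !mxE.
    by case: (v k ord0) => x y /=; rewrite mul0r subr0.
  have eIm : L *m map_mx (@complex.Im R) v = mu j *: map_mx (@complex.Im R) v.
    apply/matrixP => k l; rewrite (ord1 l) ImM ev !mxE.
    by case: (v k ord0) => x y /=; rewrite mul0r addr0.
  exists (v j0 ord0); apply/matrixP => k l; rewrite (ord1 l) [RHS]mxE.
  have := rc _ eRe k j0; have := rc _ eIm k j0.
  rewrite ![map_mx _ _ _ _]mxE.
  by case: (v k ord0) => ? ?; case: (v j0 ord0) => ? ? /= -> ->.
have l2 : 0 < lam`_1.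
  rewrite ltNge; apply/negP => le0.
  have [c0 e0] : exists c, P^t* *m delta_mx j0 ord0 = const_mx c :> 'cV_N.
    by apply: cst; rewrite muE Ij0; apply: le_trans le0; exact: lam_mono.
  have [c1 e1] : exists c, P^t* *m delta_mx j1 ord0 = const_mx c :> 'cV_N.
    by apply: cst; rewrite muE Ij1.
  have inv (x : 'cV[R[i]]_N) : P *m (P^t* *m x) = x by rewrite mulmxA PP' mul1mx.
  (* Two constant columns are proportional, and applying [P] would make two distinct basis vectors
     proportional. Entry [j1] gives [c0 = 0], so the column of [j0] would be zero. *)
  have : c1 *: (delta_mx j0 ord0 : 'cV[R[i]]_N) = c0 *: delta_mx j1 ord0.
    rewrite -[delta_mx j0 _]inv -[delta_mx j1 _]inv e0 e1 !scalemxAr.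
    by congr (_ *m _); apply/matrixP => ? ?; rewrite !mxE mulrC.
  move/matrixP => /(_ j1 ord0); rewrite !mxE !eqxx [j1 == j0]eq_sym.
  rewrite (negPf j01) /= mulr0 mulr1 => c00.
  have := inv (delta_mx j0 ord0); rewrite e0 -c00.
  move/matrixP => /(_ j0 ord0); rewrite [in RHS]mxE !eqxx mxE big1 => [/eqP|k _].
    by rewrite eq_sym oner_eq0.
  by rewrite [const_mx _ _ _]mxE mulr0.
split => // v sv.
set u := map_mx toC v; set w := P *m u.
set o : 'cV[R[i]]_N := const_mx 1; set w1 := P *m o.
have oE : o = map_mx toC (const_mx 1) by apply/matrixP => ? ?; rewrite !mxE.
(* The all-ones vector lies in the kernel of [L], so its coordinates vanish wherever the eigenvalue
   is positive. Only coordinate [j0] survives, and orthogonality to it forces [w j0 = 0]. *)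
have w1_0 j : j != j0 -> w1 j ord0 = 0.
  move=> jj0; have : P *m (map_mx toC L *m o) = 0.
    by rewrite oE -map_mxM laplacian_const map_mx0 mulmx0.
  rewrite eL !mulmxA PP' mul1mx -mulmxA -/w1 mul_diag_mx => /matrixP /(_ j ord0).
  rewrite !mxE => /eqP; rewrite mulf_eq0 => /orP[|/eqP //].
  by rewrite (inj_eq (@complexI R)) gt_eqF // (lt_le_trans l2) // mu_ge.
have tr (x y : 'cV[R[i]]_N) : (x^t* *m y) ord0 ord0 = \sum_j (x j ord0)^* * y j ord0.
  by rewrite mxE; apply: eq_bigr => j _; rewrite !mxE.
have wj0 : w j0 ord0 = 0.
  have : (o^t* *m u) ord0 ord0 = 0.
    rewrite tr; under eq_bigr => j _ do rewrite !mxE rmorph1 mul1r.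
    by rewrite -raddf_sum sv raddf0.
  have -> : o^t* *m u = w1^t* *m w.
    by rewrite /w1 /w trmx_mul map_mxM -mulmxA (mulmxA _ P) PP mul1mx.
  rewrite tr (bigD1 j0) //= big1 ?addr0; last first.
    by move=> j jj0; rewrite w1_0 // conjC0 mul0r.
  move/eqP; rewrite mulf_eq0 conjC_eq0 => /orP[/eqP w10|/eqP //].
  have : w1 = 0.
    apply/matrixP => j k; rewrite (ord1 k) [RHS]mxE.
    by have [->|jj0] := eqVneq j j0 => //; exact: w1_0.
  move/(congr1 (mulmx (P^t*))); rewrite /w1 mulmxA PP mul1mx mulmx0.
  by move/matrixP => /(_ j0 ord0); rewrite !mxE => /eqP; rewrite oner_eq0.
have nE : toC (sqnorm v) = \sum_j `|w j ord0| ^+ 2.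
  have <- : (u^t* *m u) ord0 ord0 = toC (sqnorm v).
    rewrite tr rmorph_sum; apply: eq_bigr => j _; rewrite !mxE rmorphXn /= expr2.
    by congr (_ * _); apply/CrealP; rewrite complex_real.
  have -> : u^t* *m u = w^t* *m w.
    by rewrite /w trmx_mul map_mxM -mulmxA (mulmxA _ P) PP mul1mx.
  by rewrite tr; apply: eq_bigr => j _; rewrite normCKC.
have qE : toC (dot v (L *m v)) = \sum_j toC (mu j) * `|w j ord0| ^+ 2.
  have <- : (u^t* *m (map_mx toC L *m u)) ord0 ord0 = toC (dot v (L *m v)).
    rewrite tr rmorph_sum; apply: eq_bigr => j _; rewrite -map_mxM !mxE rmorphM /=.
    by congr (_ * _); apply/CrealP; rewrite complex_real.
  have -> : u^t* *m (map_mx toC L *m u) = w^t* *m (diag_mx (\row_j toC (mu j)) *m w).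
    by rewrite /w eL trmx_mul map_mxM !mulmxA.
  rewrite tr; apply: eq_bigr => j _; rewrite mul_diag_mx !mxE normCKC.
  by rewrite mulrCA.
rewrite -lecR rmorphM /= nE qE mulr_sumr; apply: ler_sum => j _.
have [->|jj0] := eqVneq j j0; first by rewrite wj0 normr0 expr0n !mulr0.
by rewrite ler_wpM2r ?exprn_ge0 // lecR mu_ge.
Qed.

End Laplacian.

(** * Scalar recursions *)

Section Recursions.
Variable R : realType.
Implicit Types u a b c s w : nat -> R.

Lemma ler_eq (x y : R) : x = y -> x <= y.
Proof. by move=> ->. Qed.

(** Once [c k <= e / 2], the excess [u k - e / 2] is multiplied by at most [1 - a k]. Divergence of
    the sum of [a] then drives the excess below [e / 2]. *)
Lemma cvg0_of_contraction u a c :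
  (forall k, 0 <= u k) ->
  (exists K, forall k, (K <= k)%N -> 0 <= a k <= 1) ->
  (forall K B, exists n, B <= \sum_(0 <= j < n) a (K + j)%N) ->
  c @ \oo --> 0 ->
  (exists K, forall k, (K <= k)%N -> u k.+1 <= (1 - a k) * u k + a k * c k) ->
  u @ \oo --> 0.
Proof.
move=> u0 [K1 aK] adiv c0 [K2 uK]; apply/cvgrPdist_le => e e0.
have e2 : 0 < e / 2 by rewrite divr_gt0.
have /cvgrPdist_le/(_ _ e2)[K3 _ cK] := c0.
pose K := maxn K1 (maxn K2 K3).
have aK' k : (K <= k)%N -> 0 <= a k <= 1.
  by move=> h; apply/aK/(leq_trans _ h); rewrite leq_maxl.
have cK' k : (K <= k)%N -> c k <= e / 2.
  move=> h; have := cK k; rewrite /= sub0r normrN => /(_ _) H.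
  apply: le_trans (ler_norm _) (H _); apply: leq_trans h.
  by rewrite /K !leq_max leqnn !orbT.
have vK k : (K <= k)%N -> u k.+1 - e / 2 <= (1 - a k) * (u k - e / 2).
  move=> h; have /uK : (K2 <= k)%N by apply: leq_trans h; rewrite /K !leq_max leqnn orbT.
  have := cK' _ h; have /andP[? ?] := aK' _ h.
  by move=> /(ler_wpM2l (_ : 0 <= a k)) => /(_ _) H; have := H ltac:(done); lra.
pose D := Num.max (u K - e / 2) 0.
have D0 : 0 <= D by rewrite le_max lexx orbT.
(* Instead of bounding the product of the factors [1 - a] by an exponential, the proof keeps excess
   times [S] below [D]: this works since [(1 - a) * (S + a) <= S] when [S >= 1] and [a >= 0]. *)
pose S k := 1 + \sum_(0 <= j < k) a (K + j)%N.
have S1 k : 1 <= S k.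
  rewrite lerDl; apply: sumr_ge0 => j _.
  by have /andP[] := aK' _ (leq_addr j K).
have inv k : (u (K + k)%N - e / 2) * S k <= D.
  elim: k => [|k IH].
    by rewrite /S big_geq // addr0 mulr1 addn0 le_max lexx.
  have [v0|v0] := leP (u (K + k.+1)%N - e / 2) 0.
    by apply: le_trans D0; rewrite mulr_le0_ge0 // (le_trans _ (S1 _)).
  have /andP[a0 a1] := aK' _ (leq_addr k K).
  have vle := vK _ (leq_addr k K); rewrite -addnS in vle.
  have SE : S k.+1 = S k + a (K + k)%N by rewrite /S big_nat_recr //= addrA.
  have Sk := S1 k.
  apply: le_trans (_ : (1 - a (K + k)%N) * (u (K + k)%N - e / 2) * S k.+1 <= _).
    by rewrite ler_wpM2r // (le_trans _ (S1 _)).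
  (* A positive excess now implies a positive excess before, so the factor inequality may be
     multiplied by it. *)
  have v0' : 0 < u (K + k)%N - e / 2.
    rewrite ltNge; apply/negP => v0'; have := lt_le_trans v0 vle.
    by rewrite ltNge mulr_ge0_le0 // subr_ge0.
  apply: le_trans IH; rewrite mulrAC mulrC ler_wpM2l ?(ltW v0') // SE.
  have : 0 <= a (K + k)%N * (S k - 1) by rewrite mulr_ge0 // subr_ge0.
  by have := sqr_ge0 (a (K + k)%N); lra.
have Smono k n : (k <= n)%N -> S k <= S n.
  move=> kn; rewrite lerD2l (@big_cat_nat _ _ _ k 0 n) //= lerDl.
  by apply: sumr_ge0 => j _; have /andP[] := aK' _ (leq_addr j K).
have [n0 hn0] := adiv K (D / (e / 2)).
exists (K + n0)%N => // k /= Kk; rewrite sub0r normrN ger0_norm //.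
have [m km] : exists m, k = (K + m)%N.
  by exists (k - K)%N; rewrite subnKC // (leq_trans (leq_addr _ _) Kk).
rewrite km in Kk *; rewrite leq_add2l in Kk.
have [v0|v0] := leP (u (K + m)%N - e / 2) 0; first by lra.
have Sm : D / (e / 2) <= S m.
  by apply: le_trans (Smono _ _ Kk); apply: le_trans hn0 _; rewrite /S lerDr.
have : (u (K + m)%N - e / 2) * (D / (e / 2)) <= D.
  by apply: le_trans (inv m); rewrite ler_wpM2l // ltW.
have [D00|Dp] := eqVneq D 0.
  by have := inv m; rewrite D00 pmulr_lle0 ?(lt_le_trans _ (S1 _)) //; lra.
rewrite mulrCA -[leRHS]mulr1 ler_pM2l ?lt_def ?Dp // ler_pdivrMr //; lra.
Qed.

(** Oresme's argument: the [k] terms starting at [1 / k] are all at least [1 / (2 k)], so every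
    doubling of the index adds at least one half. *)
Lemma harmonic_tail_diverges (m : nat) (B : R) : (0 < m)%N ->
  exists n, B <= \sum_(0 <= j < n) (m + j)%:R^-1.
Proof.
move=> m0.
have block k : (0 < k)%N -> 1 / 2 <= \sum_(0 <= j < k) ((k + j)%:R^-1 : R).
  move=> k0; apply: le_trans (_ : \sum_(0 <= j < k) (k + k)%:R^-1 <= _).
    rewrite sumr_const_nat subn0 natrD -mulr_natr.
    have : (0 : R) < k%:R by rewrite ltr0n.
    by move=> ?; apply: ler_eq; field; lra.
  rewrite !big_nat; apply: ler_sum => j /= jk.
  by rewrite lef_pV2 ?posrE ?ltr0n ?addn_gt0 ?k0 // ler_nat leq_add2l ltnW.
suff H (p : nat) : exists n, p%:R / 2 <= \sum_(0 <= j < n) ((m + j)%:R^-1 : R).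
  have [n hn] := H (Num.bound (2 * `|B|)); exists n; apply: le_trans hn.
  have := archi_boundP (_ : 0 <= 2 * `|B|); rewrite mulr_ge0 // => /(_ isT).
  by have := ler_norm B; lra.
elim: p => [|p [n IH]]; first by exists 0%N; rewrite big_geq // mul0r.
(* After [n] terms the next index is [m + n], and a block of that same length follows. *)
exists (n + (m + n))%N; rewrite (@big_cat_nat _ _ _ n) ?leq_addr //=.
rewrite -[X in _ + \sum_(X <= _ < _) _]add0n big_addn addKn.
have -> : \sum_(0 <= i < m + n) (m + (i + n))%:R^-1 =
    \sum_(0 <= i < m + n) (m + n + i)%:R^-1 :> R.
  by apply: eq_bigr => i _; rewrite [(i + n)%N]addnC addnA.
have := block (m + n)%N; rewrite addn_gt0 m0 => /(_ isT).
by rewrite -(natr1 p); lra.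
Qed.

(** Comparison principle: from step [K] on, [C * s] satisfies the recursion with the inequality
    reversed as soon as [C >= B]. The other summands of [C] are there to dominate [u] at the
    finitely many indices up to [K]. *)
Lemma dominated_of_supersolution u a b s B K :
  (forall k, 0 <= u k) -> (forall k, 0 < s k) -> 0 <= B ->
  (forall k, (K <= k)%N -> a k <= 1) ->
  (forall k, (K <= k)%N -> u k.+1 <= (1 - a k) * u k + b k) ->
  (forall k, (K <= k)%N -> 0 <= s k.+1 - (1 - a k) * s k) ->
  (forall k, (K <= k)%N -> b k <= B * (s k.+1 - (1 - a k) * s k)) ->
  exists2 C, 0 <= C & forall k, u k <= C * s k.
Proof.
move=> u0 s0 B0 a1 uK sK bK.
pose C := B + \sum_(j < K.+1) u j / s j.
have us j : 0 <= u j / s j by rewrite divr_ge0 // ltW.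
have sum0 (P : pred 'I_K.+1) : 0 <= \sum_(j < K.+1 | P j) u j / s j by apply: sumr_ge0.
have C0 : 0 <= C by rewrite addr_ge0.
exists C => // k.
have small j : (j <= K)%N -> u j <= C * s j.
  move=> jK; rewrite -ler_pdivrMr // /C (bigD1 (Ordinal (jK : (j < K.+1)%N))) //=.
  by rewrite addrCA lerDl addr_ge0.
have [kK|Kk] := leqP k K; first exact: small.
rewrite -(subnKC (ltnW Kk)); elim: (k - K)%N => [|m IH].
  by rewrite addn0 small.
have hm := leq_addr m K.
rewrite addnS; apply: le_trans (uK _ hm) _.
apply: le_trans (_ : (1 - a (K + m)%N) * (C * s (K + m)%N) +
   C * (s (K + m).+1 - (1 - a (K + m)%N) * s (K + m)%N) <= _); last first.
  by apply: ler_eq; ring.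
apply: lerD; first by rewrite ler_wpM2l // subr_ge0 a1.
apply: le_trans (bK _ hm) _; rewrite ler_wpM2r ?sK //.
by rewrite /C lerDl.
Qed.

End Recursions.

(** * Rate classes and the two Lyapunov recursions *)

Section RateClasses.
Variable R : realType.

(* Lets the passage from outputs to states be done once for both parts of the
   theorem: convergence to 0 and O(1/t) are the two instances. *)
Record rate_class (S : (nat -> R) -> Prop) : Prop := RateClass {
  rate_dom : forall u v C, 0 <= C -> (forall k, 0 <= u k <= C * v k) -> S v -> S u;
  rate_add : forall u v, S u -> S v -> S (fun k => u k + v k);
  rate_filter : forall r C u w, 0 <= r < 1 -> 0 <= C -> (forall k, 0 <= u k) ->
    (forall k, u k.+1 <= r * u k + C * w k) -> S w -> S u }.

Lemma rate_class_cvg0 : rate_class (fun u : nat -> R => u @ \oo --> 0).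
Proof.
split.
- move=> u v C C0 uv v0.
  have Cv : C * v k @[k --> \oo] --> 0 by rewrite -(mulr0 C); exact: cvgMl_tmp.
  have uv' : \forall k \near \oo, (fun=> 0) k <= u k <= C * v k by exact: nearW.
  exact: (squeeze_cvgr uv' (cvg_cst _) Cv).
- by move=> u v u0 v0; rewrite -(addr0 0); exact: cvgD.
- move=> r C u w /andP[r0 r1] C0 u0 uw w0.
  have r1' : 0 < 1 - r by rewrite subr_gt0.
  apply: (@cvg0_of_contraction _ u (fun=> 1 - r) (fun k => C / (1 - r) * w k)) => //.
  + by exists 0%N => k _; lra.
  + move=> K B; exists (Num.bound (`|B| / (1 - r))).
    rewrite sumr_const_nat subn0 -mulr_natr.
    have := archi_boundP (_ : 0 <= `|B| / (1 - r)).
    rewrite divr_ge0 ?(ltW r1') // => /(_ isT).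
    rewrite ltr_pdivrMr //; have := ler_norm B; set n := _%:R; lra.
  + by rewrite -(mulr0 (C / (1 - r))); exact: cvgMl_tmp.
  + exists 0%N => k _; apply: le_trans (uw k) _; apply: ler_eq.
    by field; lra.
Qed.

Lemma rate_class_bigO (t0 : nat) : rate_class (fun u : nat -> R =>
  exists2 C, 0 <= C & forall k, u k <= C * (t0 + 1 + k)%:R^-1).
Proof.
split.
- move=> u v C C0 uv [D D0 vD]; exists (C * D); rewrite ?mulr_ge0 // => k.
  have /andP[_ h] := uv k; apply: le_trans h _.
  by rewrite -mulrA ler_wpM2l.
- move=> u v [C C0 uC] [D D0 vD]; exists (C + D); rewrite ?addr_ge0 // => k.
  by rewrite mulrDl lerD.
- move=> r C u w /andP[r0 r1] C0 u0 uw [D D0 wD].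
  have r1' : 0 < 1 - r by rewrite subr_gt0.
  (* Beyond this index [t > (1 + r) / (1 - r)], which is what makes [1 / (t + 1) - r / t] at least
     half of [(1 - r) / t]. *)
  pose K := Num.bound ((1 + r) / (1 - r)).
  have gap k : (K <= k)%N -> (1 - r) / 2 * (t0 + 1 + k)%:R^-1 <=
      (t0 + 1 + k.+1)%:R^-1 - (1 - (1 - r)) * (t0 + 1 + k)%:R^-1.
    move=> Kk; rewrite (addnS (t0 + 1)%N) -(natr1 (t0 + 1 + k)%N); set t : R := (t0 + 1 + k)%:R.
    have : (1 + r) / (1 - r) < t.
      apply: lt_le_trans (archi_boundP _) _; first by rewrite divr_ge0 //; lra.
      by rewrite ler_nat (leq_trans Kk) // leq_addl.
    rewrite ltr_pdivrMr // => ht.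
    have t1 : 1 <= t by rewrite ler1n addn1 addSn.
    rewrite -subr_ge0.
    have -> : (t + 1)^-1 - (1 - (1 - r)) / t - (1 - r) / 2 / t =
       ((t * (1 - r) - (1 + r)) / 2) / (t * (t + 1)) by field; lra.
    by rewrite divr_ge0 //; [lra|rewrite mulr_ge0; lra].
  apply: (@dominated_of_supersolution _ u (fun=> 1 - r) (fun k => C * w k) _
    (C * D / ((1 - r) / 2)) K) => //.
  + by rewrite divr_ge0 ?mulr_ge0 // ltW.
  + by move=> k _; lra.
  + by move=> k _; rewrite subKr.
  + move=> k Kk; apply: le_trans (gap _ Kk).
    by rewrite mulr_ge0 // divr_ge0 // ltW.
  + move=> k Kk; apply: le_trans (_ : C * D / ((1 - r) / 2) *
       ((1 - r) / 2 * (t0 + 1 + k)%:R^-1) <= _); last first.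
      by rewrite ler_wpM2l ?gap // divr_ge0 ?mulr_ge0 // ltW.
    rewrite mulrA divfK ?gt_eqF ?divr_gt0 // -mulrA ler_wpM2l //.
Qed.

(** The source is [rho / t] times the null sequence [C / (rho * t)], and the steps [rho / t] have a
    divergent sum. *)
Lemma cvg0_of_lyapunov (t0 : nat) (u : nat -> R) (rho C : R) :
  0 < rho -> 0 <= C -> (forall k, 0 <= u k) ->
  (forall k, u k.+1 <= (1 - rho / (t0 + 1 + k)%:R) * u k + C / (t0 + 1 + k)%:R ^+ 2) ->
  u @ \oo --> 0.
Proof.
move=> rho0 C0 u0 uk.
have tp k : (0 : R) < (t0 + 1 + k)%:R by rewrite ltr0n addn1.
apply: (@cvg0_of_contraction _ u (fun k => rho / (t0 + 1 + k)%:R)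
  (fun k => C / rho * (t0 + 1 + k)%:R^-1)) => //.
- exists (Num.bound rho) => k hk; rewrite divr_ge0 ?(ltW rho0) //= ler_pdivrMr // mul1r.
  apply: le_trans (ltW (archi_boundP (ltW rho0))) _.
  by rewrite ler_nat (leq_trans hk) // leq_addl.
- move=> K B; have t1 : (0 < t0 + 1 + K)%N by rewrite addn1.
  have [n hn] := harmonic_tail_diverges (B / rho) t1; exists n; rewrite -mulr_sumr mulrC -ler_pdivrMr //.
  by apply: le_trans hn _; apply: ler_eq; apply: eq_bigr => j _; rewrite addnA.
- rewrite -(mulr0 (C / rho)); apply: cvgMl_tmp.
  have th k : (fun=> 0 : R) k <= (t0 + 1 + k)%:R^-1 <= (harmonic k : R).
    rewrite invr_ge0 ltW //= lef_pV2 ?posrE ?ltr0n ?addn1 //.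
    by rewrite ler_nat addSn ltnS leq_addl.
  have th' : \forall k \near \oo, (fun=> 0 : R) k <= (t0 + 1 + k)%:R^-1 <= (harmonic k : R).
    by exists 0%N => // k _; exact: th.
  have c0 : (fun=> 0 : R) k @[k --> \oo] --> (0 : R) by exact: cvg_cst.
  have h0 : (harmonic k : R) @[k --> \oo] --> (0 : R) by exact: cvg_harmonic.
  exact: (squeeze_cvgr th' c0 h0).
- exists 0%N => k _; apply: le_trans (uk k) _; rewrite lerD2l.
  by apply: ler_eq; field; have := tp k; lra.
Qed.

(** A form of Chung's lemma. For [s = 1 / t] the supersolution gap exceeds [(rho - 1) / t ^+ 2] by
    [1 / (t ^+ 2 * (t + 1))]; since [rho > 1], a multiple of it covers the source. *)
Lemma bigO_of_lyapunov (t0 : nat) (u : nat -> R) (rho C : R) :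
  1 < rho -> 0 <= C -> (forall k, 0 <= u k) ->
  (forall k, u k.+1 <= (1 - rho / (t0 + 1 + k)%:R) * u k + C / (t0 + 1 + k)%:R ^+ 2) ->
  exists2 D, 0 <= D & forall k, u k <= D * (t0 + 1 + k)%:R^-1.
Proof.
move=> rho1 C0 u0 uk.
have tp k : (0 : R) < (t0 + 1 + k)%:R by rewrite ltr0n addn1.
have gap k : (rho - 1) / (t0 + 1 + k)%:R ^+ 2 <=
    (t0 + 1 + k.+1)%:R^-1 - (1 - rho / (t0 + 1 + k)%:R) * (t0 + 1 + k)%:R^-1.
  rewrite (addnS (t0 + 1)%N) -(natr1 (t0 + 1 + k)%N).
  have := tp k; set t : R := (t0 + 1 + k)%:R => t0'.
  rewrite -subr_ge0.
  have -> : (t + 1)^-1 - (1 - rho / t) / t - (rho - 1) / t ^+ 2 =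
     (t ^+ 2 * (t + 1))^-1 by field; lra.
  by rewrite invr_ge0 mulr_ge0 ?exprn_ge0; lra.
apply: (@dominated_of_supersolution _ u (fun k => rho / (t0 + 1 + k)%:R)
  (fun k => C / (t0 + 1 + k)%:R ^+ 2) _ (C / (rho - 1)) (Num.bound rho)) => //.
- by rewrite divr_ge0 //; lra.
- move=> k hk; rewrite ler_pdivrMr // mul1r.
  apply: le_trans (ltW (archi_boundP _)) _; first by lra.
  by rewrite ler_nat (leq_trans hk) // leq_addl.
- by move=> k _; apply: le_trans (gap k); rewrite divr_ge0 ?exprn_ge0 ?ltW //; lra.
- move=> k _; apply: le_trans (_ : C / (rho - 1) * ((rho - 1) / (t0 + 1 + k)%:R ^+ 2) <= _).
    by rewrite mulrA divfK //; lra.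
  by rewrite ler_wpM2l ?gap // divr_ge0 //; lra.
Qed.

End RateClasses.

(** * The Gaussian distribution function *)

Section Gaussian.
Variables (R : realType) (sigma : R).
Hypothesis sigma_gt0 : 0 < sigma.

Let sigma_neq0 : sigma != 0. Proof. by rewrite gt_eqF. Qed.

Lemma gaussf_gt0 x : 0 < gaussf sigma x.
Proof.
rewrite /gaussf normal_pdfE // mulr_gt0 ?expR_gt0 //.
exact: normal_peak_gt0.
Qed.

Lemma gaussf_antitone x y : `|x| <= y -> gaussf sigma y <= gaussf sigma x.
Proof.
move=> xy; rewrite /gaussf !normal_pdfE // ler_wpM2l ?normal_peak_ge0 //.
rewrite ler_expR ler_wpM2r ?invr_ge0 ?mulrn_wge0 ?sqr_ge0 // !subr0 lerN2.
by rewrite -[x ^+ 2]real_normK ?num_real // ler_sqr ?nnegrE // (le_trans _ xy).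
Qed.

Lemma normal_prob_fin_num (B : set R) : measurable B ->
  normal_prob 0 sigma B \is a fin_num.
Proof. by move=> mB; exact: fin_num_measure. Qed.

Lemma EFin_gaussF x : (gaussF sigma x)%:E = normal_prob 0 sigma `]-oo, x].
Proof. by rewrite /gaussF fineK // normal_prob_fin_num. Qed.

Lemma gaussF_ge0 x : 0 <= gaussF sigma x.
Proof. by rewrite /gaussF fine_ge0 // measure_ge0. Qed.

Lemma gaussF_le1 x : gaussF sigma x <= 1.
Proof. by rewrite -lee_fin EFin_gaussF probability_le1. Qed.

(** The increment is the integral of the density over []x, y]], and on [[-m, m]] the even, unimodal
    density is smallest at [m]. *)
Lemma gaussF_increment m x y : x <= y -> `|x| <= m -> `|y| <= m ->
  gaussf sigma m * (y - x) <= gaussF sigma y - gaussF sigma x.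
Proof.
move=> xy xm ym; rewrite -lee_fin EFinB !EFin_gaussF.
have -> : normal_prob 0 sigma `]-oo, y] =
    (normal_prob 0 sigma `]-oo, x] + normal_prob 0 sigma `]x, y])%E.
  rewrite -measureU //.
    by rewrite -itv_bndbnd_setU // bnd_simp.
  apply/seteqP; split => // z [] /=; rewrite !in_itv /= => zx /andP[xz _].
  by move: (lt_le_trans xz zx); rewrite ltxx.
rewrite addeAC subee ?normal_prob_fin_num // add0e.
apply: le_trans (_ : (\int[lebesgue_measure]_(z in `]x, y]) (gaussf sigma m)%:E <= _)%E).
  rewrite integral_cst //= lebesgue_measure_itv /= lte_fin.
  by move: xy; case: ltgtP => [xy _|//|-> _]; rewrite ?subrr ?mulr0 ?mule0.
rewrite /normal_prob; apply: ge0_le_integral => //=.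
- by move=> z _; rewrite lee_fin ltW // gaussf_gt0.
- apply/measurable_EFinP; apply: measurable_funTS; exact: measurable_normal_pdf.
- move=> z; rewrite in_itv /= => /andP[xz zy]; rewrite lee_fin.
  apply: gaussf_antitone; rewrite ler_norml.
  move: xm ym; rewrite !ler_norml => /andP[h _] /andP[_ h'].
  by rewrite (le_trans h (ltW xz)) (le_trans zy).
Qed.

(** Strong monotonicity of the distribution function, the origin of the constant f_M: it will be
    applied with [m = |c_ij| + M]. *)
Lemma gaussF_monotone_gap m x y : `|x| <= m -> `|y| <= m ->
  gaussf sigma m * (x - y) ^+ 2 <= (x - y) * (gaussF sigma x - gaussF sigma y).
Proof.
move=> xm ym; have [xy|/ltW yx] := leP x y.
  have := gaussF_increment xy xm ym.
  have : 0 <= y - x by rewrite subr_ge0.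
  by move=> /ler_wpM2l h /h; lra.
have := gaussF_increment yx ym xm.
have : 0 <= x - y by rewrite subr_ge0.
by move=> /ler_wpM2l h /h; lra.
Qed.

End Gaussian.

(** * Reduction to a finite Markov chain *)

Section BitChain.
Variables (R : realType) (n N : nat) (adj : rel 'I_N).
Variables (a : 'I_n -> R) (b : 'I_n.-1 -> R) (c : 'I_N -> 'I_N -> R).
Variables (sigma beta gamma M : R) (t0 : nat).

Definition state := (('I_N -> 'cV[R]_n) * ('I_N -> 'I_N -> R))%type.

Definition output (st : state) (i : 'I_N) : R := sc (K2 b *m st.1 i).

(* [sb] is the set of pairs (i, j) with s_ij(t) = 1. *)
Definition bit_step (t : nat) (st : state) (sb : {set 'I_N * 'I_N}) : state :=
  let Z' i j := if adj i j then
      projM M (st.2 i j + beta / t%:R *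
        (gaussF sigma (c i j - st.2 i j) - ((i, j) \in sb)%:R))
    else st.2 i j in
  let u i := sc (K1 a b *m st.1 i)
      + gamma / (t.+1)%:R * \sum_(j in nbrs adj i) (Z' i j - output st i) in
  (fun i => Amx a *m st.1 i + u i *: Bvec R n, Z').

(** Off the edges the parameter is 0. A set of pairs containing a non-edge then gets probability 0,
    and sums may range over all sets of pairs. *)
Definition bit_prob (st : state) (p : 'I_N * 'I_N) : R :=
  if adj p.1 p.2 then gaussF sigma (c p.1 p.2 - output st p.2) else 0.

Definition bits_prob (st : state) (sb : {set 'I_N * 'I_N}) : R :=
  \prod_p (if p \in sb then bit_prob st p else 1 - bit_prob st p).

(** [k] counts the steps already made and [m] those left. The recursion peels off the first step, as
    conditioning on the bits does; [expectSr] peels off the last one, where the drift bounds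
    apply. *)
Fixpoint expect (m k : nat) (st : state) (phi : state -> R) : R :=
  if m is m'.+1 then
    \sum_sb bits_prob st sb * expect m' k.+1 (bit_step (t0 + k).+1 st sb) phi
  else phi st.

Definition transition (k : nat) (phi : state -> R) (st : state) : R :=
  \sum_sb bits_prob st sb * phi (bit_step (t0 + k).+1 st sb).

Lemma expectSr m k st phi :
  expect m.+1 k st phi = expect m k st (transition (k + m) phi).
Proof.
elim: m k st => [|m IH] k st; first by rewrite /= /transition addn0.
transitivity (\sum_sb bits_prob st sb *
    expect m.+1 k.+1 (bit_step (t0 + k).+1 st sb) phi); first by [].
by under eq_bigr => sb _ do rewrite IH addSnnS.
Qed.

Lemma bit_prob_ge0 st p : 0 <= bit_prob st p.
Proof. by rewrite /bit_prob; case: ifP => // _; exact: gaussF_ge0. Qed.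

Lemma bit_prob_le1 st p : bit_prob st p <= 1.
Proof. by rewrite /bit_prob; case: ifP => // _; exact: gaussF_le1. Qed.

Lemma bits_prob_ge0 st sb : 0 <= bits_prob st sb.
Proof.
apply: prodr_ge0 => p _; case: ifP => _; rewrite ?bit_prob_ge0 //.
by rewrite subr_ge0 bit_prob_le1.
Qed.

Lemma sum_bits_prob st : \sum_sb bits_prob st sb = 1.
Proof. by rewrite -bigA_distr; apply: big1 => p _ /=; rewrite addrCA subrr addr0. Qed.

Lemma mean_bit st p : \sum_sb bits_prob st sb * (p \in sb)%:R = bit_prob st p.
Proof.
(* Restricting to the sets that contain [p] amounts to replacing the failure probability at [p] by
   0; the sum of products then factors. *)
pose g p' := if p' == p then 0 else 1 - bit_prob st p'.
transitivity (\sum_(sb : {set 'I_N * 'I_N})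
    \prod_p' (if p' \in sb then bit_prob st p' else g p')).
  apply: eq_bigr => sb _; have [psb|psb] := boolP (p \in sb).
    rewrite mulr1; apply: eq_bigr => p' _; rewrite /g.
    by case: (eqVneq p' p) => // ->; rewrite psb.
  by rewrite mulr0 (bigD1 p) //= (negPf psb) /g eqxx mul0r.
rewrite -bigA_distr (bigD1 p) //= /g eqxx addr0 big1 ?mulr1 // => p' /negPf ->.
by rewrite addrCA subrr addr0.
Qed.

(** * From integrals over the noise to finite sums *)

Section NoiseLaw.
Variables (dT : measure_display) (T : measurableType dT) (P : probability T R).
Variable d : 'I_N -> 'I_N -> nat -> T -> R.
Hypotheses (d_meas : forall i j t, adj i j -> measurable_fun setT (d i j t))
  (d_law : forall i j t, adj i j -> forall B : set R, measurable B ->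
      P (d i j t @^-1` B) = normal_prob 0 sigma B)
  (d_indep : mutually_independent P
      (fun p : 'I_N * 'I_N * nat => adj p.1.1 p.1.2)
      (fun p => d p.1.1 p.1.2 p.2)).

Let index := ('I_N * 'I_N * nat)%type.

Definition cylinder (S : seq index) (B : index -> set R) : set T :=
  [set w | forall i, i \in S -> B i (d i.1.1 i.1.2 i.2 w)].

Definition past (t : nat) (S : seq index) (B : index -> set R) : Prop :=
  [/\ uniq S, forall i, i \in S -> adj i.1.1 i.1.2,
      forall i, i \in S -> (i.2 < t)%N & forall i, measurable (B i)].

Lemma measurable_cylinder t S B : past t S B -> measurable (cylinder S B).
Proof.
case=> _ adjS _ mB; elim: S adjS => [|i S IH] adjS.
  rewrite (_ : cylinder [::] B = setT); first exact: measurableT.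
  by apply/seteqP; split.
rewrite (_ : cylinder (i :: S) B =
  (d i.1.1 i.1.2 i.2 @^-1` B i) `&` cylinder S B).
  apply: measurableI; last by apply: IH => j jS; apply: adjS; rewrite inE jS orbT.
  rewrite -[X in measurable X]setTI.
  by apply: d_meas => //; apply: adjS; rewrite mem_head.
apply/seteqP; split=> w /=.
  move=> h; split; first by apply: h; rewrite mem_head.
  by move=> j jS; apply: h; rewrite inE jS orbT.
by move=> [h1 h2] j; rewrite inE => /orP[/eqP -> //|]; exact: h2.
Qed.

Lemma prob_cylinder t S B : past t S B ->
  P (cylinder S B) = (\prod_(i <- S) P (d i.1.1 i.1.2 i.2 @^-1` B i))%E.
Proof. by case=> uS adjS _ mB; exact: d_indep. Qed.

Definition bits_event (t : nat) (st : state) (sb : {set 'I_N * 'I_N}) : set T :=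
  [set w | forall p, (p \in sb) =
    adj p.1 p.2 && (output st p.2 + d p.1 p.2 t w <= c p.1 p.2)].

(** For a fixed state, the received bits at time [t] constrain only the noises of time [t]. These
    indices are new with respect to a past cylinder, so the intersection is again a cylinder, and
    independence splits off the probability of the bits. *)
Lemma bits_event_cylinder t st (sb : {set 'I_N * 'I_N}) S B : past t S B -> sb \subset pairs adj ->
  exists S' B', [/\ past t.+1 S' B',
    cylinder S B `&` bits_event t st sb = cylinder S' B' &
    P (cylinder S' B') = (P (cylinder S B) * (bits_prob st sb)%:E)%E].
Proof.
move=> pS sbp; have [uS adjS ltS mB] := pS.
pose I p : set R := [set` `]-oo, c p.1 p.2 - output st p.2]].
(* Bit 1 on [p] means that the noise is at most the threshold minus the output, bit 0 the
   complement. [B'] decides by the time stamp which constraint applies. *)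
pose H p : set R := if p \in sb then I p else ~` I p.
pose S2 : seq index := [seq (p, t) | p <- enum (pairs adj)].
pose B' (i : index) := if (i.2 < t)%N then B i else H i.1.
have S2P i : (i \in S2) = (i.2 == t) && adj i.1.1 i.1.2.
  apply/mapP/andP => [[p]|[/eqP it ai]].
    by rewrite mem_enum inE => ap -> /=; rewrite eqxx.
  by exists i.1; rewrite ?mem_enum ?inE // -it; case: i {it ai}.
have mH p : measurable (H p).
  by rewrite /H; case: ifP => _; [|apply: measurableC]; exact: measurable_itv.
have pS' : past t.+1 (S ++ S2) B'.
  split.
  - rewrite cat_uniq uS /= map_inj_uniq ?enum_uniq ?andbT; last by move=> ? ? [].
    apply/hasPn => i; rewrite S2P => /andP[/eqP it _].
    by apply/negP => /ltS; rewrite it ltnn.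
  - by move=> i; rewrite mem_cat => /orP[/adjS //|]; rewrite S2P => /andP[].
  - move=> i; rewrite mem_cat => /orP[/ltS/ltnW //|].
    by rewrite S2P => /andP[/eqP -> _].
  - by move=> i; rewrite /B'; case: ifP.
exists (S ++ S2), B'; split => //.
  apply/seteqP; split => w /=.
    move=> [wS wb] i; rewrite mem_cat => /orP[iS|].
      by rewrite /B' ltS //; exact: wS.
    rewrite S2P => /andP[/eqP it ai]; rewrite /B' it ltnn /H wb ai /= /I.
    by case: ifP => h; rewrite /= in_itv /= lerBrDl // h.
  move=> h; split.
    by move=> i iS; have := h i; rewrite mem_cat iS => /(_ isT); rewrite /B' ltS.
  move=> p; have [ap|nap] := boolP (adj p.1 p.2); last first.
    apply/negbTE/negP => psb; have := fintype.subsetP sbp _ psb.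
    by rewrite inE (negPf nap).
  have := h (p, t); rewrite mem_cat S2P eqxx ap orbT => /(_ isT).
  rewrite /B' ltnn /H /I /=; case: ifP => _; rewrite /= in_itv /= lerBrDl.
    by move=> ->.
  by move/negP/negbTE => ->.
rewrite (prob_cylinder pS') (prob_cylinder pS) big_cat /=; congr (_ * _)%E.
  apply: eq_big_seq => i iS; congr (P (_ @^-1` _)).
  by rewrite /B' ltS.
rewrite big_map big_enum /= /bits_prob.
rewrite [in RHS](bigID (fun p => p \in pairs adj)) /= [X in _ * X]big1 ?mulr1; last first.
  move=> p npp; rewrite ifN; last by apply: contra npp; exact: (fintype.subsetP sbp).
  by rewrite /bit_prob; move: npp; rewrite inE => /negPf ->; rewrite subr0.
rewrite -prodEFin; apply: eq_bigr => p; rewrite inE => ap.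
rewrite /B' /= ltnn d_law // /H /bit_prob ap; case: ifP => _.
  by rewrite EFin_gaussF.
rewrite probability_setC; last exact: measurable_itv.
by rewrite EFinB EFin_gaussF.
Qed.

Lemma bits_event_nsub t st (sb : {set 'I_N * 'I_N}) : ~~ (sb \subset pairs adj) ->
  bits_event t st sb = set0 /\ bits_prob st sb = 0.
Proof.
case/fintype.subsetPn => p psb; rewrite inE => nap; split.
  apply/seteqP; split => // w /(_ p); rewrite psb (negPf nap) //.
by rewrite /bits_prob (bigD1 p) //= psb /bit_prob (negPf nap) mul0r.
Qed.

Lemma past_nil t : past t [::] (fun=> setT).
Proof. by split => // i; exact: measurableT. Qed.

Lemma cylinder_nil B : cylinder [::] B = setT.
Proof. by apply/seteqP; split. Qed.

Lemma measurable_bits_event t st sb : measurable (bits_event t st sb).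
Proof.
have [sbp|nsb] := boolP (sb \subset pairs adj); last first.
  by rewrite (bits_event_nsub t st nsb).1; exact: measurable0.
have [S' [B' [pS' e _]]] := bits_event_cylinder st (past_nil t) sbp.
rewrite -[bits_event _ _ _]setTI -(cylinder_nil (fun=> setT)) e.
exact: (measurable_cylinder pS').
Qed.

Local Notation step := (step adj a b c sigma beta gamma M).

(** Unlike [traj], this peels off the first step from an arbitrary starting state, so that an
    induction can restart from the state reached after the first bits. *)
Fixpoint traj_from (m k : nat) (st : state) (w : T) : state :=
  if m is m'.+1 then
    traj_from m' k.+1 (step (t0 + k).+1 st (fun i j => d i j (t0 + k).+1 w)) w
  else st.

Lemma traj_fromSr m k st w : traj_from m.+1 k st w =
  step (t0 + (k + m)).+1 (traj_from m k st w) (fun i j => d i j (t0 + (k + m)).+1 w).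
Proof.
elim: m k st => [|m IH] k st; first by rewrite addn0.
by rewrite [LHS]IH addSnnS.
Qed.

Lemma traj_fromE x0 z0 k w :
  traj adj a b c sigma beta gamma M t0 x0 z0 d k w = traj_from k 0 (x0, z0) w.
Proof. by elim: k => // k IH; rewrite traj_fromSr -IH. Qed.

Definition received (t : nat) (st : state) (w : T) : {set 'I_N * 'I_N} :=
  [set p | adj p.1 p.2 && (output st p.2 + d p.1 p.2 t w <= c p.1 p.2)].

Lemma step_received t st w :
  step t st (fun i j => d i j t w) = bit_step t st (received t st w).
Proof.
have eZ : (step t st (fun i j => d i j t w)).2 = (bit_step t st (received t st w)).2.
  apply/funext => i; apply/funext => j /=; case: ifP => // aij.
  by rewrite inE /= aij /output; case: ifP.
rewrite [LHS]surjective_pairing [RHS]surjective_pairing eZ; congr (_, _).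
apply/funext => i /=; congr (_ + (_ + _ * _) *: _).
apply: eq_bigr => j _; congr (_ - _).
exact: (congr1 (fun f => f i j) eZ).
Qed.

Lemma bits_eventE t st sb w :
  bits_event t st sb w <-> sb = received t st w.
Proof.
split=> [h|-> p]; last by rewrite inE.
by apply/finset.setP => p; rewrite h inE.
Qed.

(** At each [w] exactly one bit pattern occurs, and on its event the next state is a constant. A
    random starting state is thereby traded for a finite sum over deterministic ones. *)
Lemma traj_from_decomp m k st (phi : state -> R) w :
  phi (traj_from m.+1 k st w) = \sum_sb \1_(bits_event (t0 + k).+1 st sb) w *
    phi (traj_from m k.+1 (bit_step (t0 + k).+1 st sb) w).
Proof.
rewrite (bigD1 (received (t0 + k).+1 st w)) //= step_received big1 ?addr0.
  by rewrite indicE mem_set ?mul1r //; apply/bits_eventE.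
move=> sb /eqP ne; rewrite indicE memNset ?mul0r //.
by move/bits_eventE.
Qed.

(** Holds for arbitrary [phi] since the state takes finitely many values: repeated decomposition
    leaves a finite sum of constants times indicators. *)
Lemma measurable_traj_from m k st (phi : state -> R) :
  measurable_fun setT (fun w => phi (traj_from m k st w)).
Proof.
elim: m k st => [|m IH] k st; first by rewrite /=; exact: measurable_cst.
under eq_fun do rewrite traj_from_decomp.
apply: measurable_sum => sb; apply: measurable_funM; last exact: IH.
by apply: measurable_indic; exact: measurable_bits_event.
Qed.

(** Carrying the indicator of a past cylinder through the induction replaces conditional
    expectations: the current bits are absorbed into the cylinder, whose probability is thereby
    multiplied by [bits_prob]. *)
Lemma integral_traj_from m k st S B (phi : state -> R) :
  (forall s, 0 <= phi s) -> past (t0 + k).+1 S B ->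
  (\int[P]_w (\1_(cylinder S B) w * phi (traj_from m k st w))%:E =
   P (cylinder S B) * (expect m k st phi)%:E)%E.
Proof.
move=> phi0; elim: m k st S B => [|m IH] k st S B pS.
  rewrite /=; under eq_integral do rewrite mulrC EFinM.
  rewrite ge0_integralZl_EFin //; last first.
    apply/measurable_EFinP; apply: measurable_indic.
    exact: (measurable_cylinder pS).
  rewrite integral_indic //; last exact: (measurable_cylinder pS).
  by rewrite setIT muleC.
set t := (t0 + k).+1.
transitivity (\int[P]_w (\sum_sb (\1_(cylinder S B `&` bits_event t st sb) w *
    phi (traj_from m k.+1 (bit_step t st sb) w))%:E))%E.
  apply: eq_integral => w _; rewrite traj_from_decomp mulr_sumr sumEFin.
  by congr EFin; apply: eq_bigr => sb _; rewrite indicI mulrA.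
rewrite ge0_integral_sum //; last 2 first.
- move=> sb; apply/measurable_EFinP; apply: measurable_funM; last first.
    exact: measurable_traj_from.
  apply: measurable_indic; apply: measurableI.
    exact: (measurable_cylinder pS).
  exact: measurable_bits_event.
- by move=> sb w _; rewrite lee_fin mulr_ge0.
transitivity (\sum_sb (P (cylinder S B) * (bits_prob st sb *
   expect m k.+1 (bit_step t st sb) phi)%:E))%E.
  apply: eq_bigr => sb _.
  have [sbp|nsb] := boolP (sb \subset pairs adj); last first.
    have [-> ->] := bits_event_nsub t st nsb.
    rewrite mul0r mule0; apply: integral0_eq => w _.
    by rewrite setI0 indic0 mul0r.
  have [S' [B' [pS' -> PS']]] := bits_event_cylinder st pS sbp.
  by rewrite IH ?addnS // PS' EFinM muleA.
rewrite -ge0_sume_distrr; first by rewrite sumEFin.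
move=> sb _; rewrite lee_fin mulr_ge0 ?bits_prob_ge0 //.
elim: m k.+1 (bit_step t st sb) {IH} => //= m IH k' st'.
by apply: sumr_ge0 => ? _; rewrite mulr_ge0 ?bits_prob_ge0.
Qed.

Lemma integral_traj x0 z0 k (phi : state -> R) : (forall s, 0 <= phi s) ->
  (\int[P]_w (phi (traj adj a b c sigma beta gamma M t0 x0 z0 d k w))%:E =
   (expect k 0 (x0, z0) phi)%:E)%E.
Proof.
move=> phi0; have := integral_traj_from k (x0, z0) phi0 (past_nil (t0 + 0).+1).
rewrite cylinder_nil probability_setT mul1e => <-.
by apply: eq_integral => w _; rewrite indicT mul1r traj_fromE.
Qed.

End NoiseLaw.
End BitChain.

(** * One-step bounds *)

Section GraphMatrices.
Variables (R : realType) (N : nat) (adj : rel 'I_N).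
Local Notation W := (Wmx R adj).
Local Notation Q := (Qmx R adj).
Local Notation J := (JN R N).
Local Notation L := (laplacian R adj).

Lemma pair_ofP (p : 'I_(npairs adj)) : adj (pair_of p).1 (pair_of p).2.
Proof. by have := enum_valP p; rewrite inE. Qed.

Lemma pair_of_surj i j : adj i j -> exists p : 'I_(npairs adj), pair_of p = (i, j).
Proof.
move=> aij; have ijP : (i, j) \in pairs adj by rewrite inE.
by exists (enum_rank_in ijP (i, j)); rewrite /pair_of enum_rankK_in.
Qed.

Lemma Qmx_mulE (v : 'cV[R]_N) p : (Q *m v) p ord0 = v (pair_of p).2 ord0.
Proof.
rewrite mxE (bigD1 (pair_of p).2) //= mxE eqxx mul1r big1 ?addr0 // => k kp.
by rewrite mxE eq_sym (negPf kp) mul0r.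
Qed.

Lemma Wmx_mulE (f : 'I_N -> 'I_N -> R) i :
  (W *m \col_p f (pair_of p).1 (pair_of p).2) i ord0 = \sum_(j in nbrs adj i) f i j.
Proof.
rewrite mxE; under eq_bigr => p _ do rewrite !mxE.
rewrite -(big_enum_val (fun q : 'I_N * 'I_N => (q.1 == i)%:R * f q.1 q.2)) /=.
rewrite big_mkcond /=; under eq_bigr => q _ do rewrite inE.
rewrite -(pair_bigA _ (fun k j => if adj k j then (k == i)%:R * f k j else 0)) /=.
rewrite (bigD1 i) //= [X in _ + X]big1 ?addr0.
  rewrite [RHS]big_mkcond; apply: eq_bigr => j _.
  by rewrite !inE /= eqxx mul1r.
by move=> k /negPf ki; apply: big1 => j _; rewrite ki mul0r; case: ifP.
Qed.

Lemma JN_mulE (v : 'cV[R]_N) i :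
  (J *m v) i ord0 = v i ord0 - N%:R^-1 * \sum_j v j ord0.
Proof.
rewrite mulmxBl mul1mx -scalemxAl !mxE; congr (_ - _ * _).
by apply: eq_bigr => j _; rewrite mxE mul1r.
Qed.

Lemma sum_JN (v : 'cV[R]_N) : (0 < N)%N -> \sum_i (J *m v) i ord0 = 0.
Proof.
move=> N0; under eq_bigr => i _ do rewrite JN_mulE.
rewrite sumrB sumr_const card_ord -mulrnAl -[N%:R^-1 *+ N]mulr_natr mulVf ?mul1r ?subrr //.
by rewrite pnatr_eq0 -lt0n.
Qed.

Lemma laplacian_JN (v : 'cV[R]_N) : L *m (J *m v) = L *m v.
Proof.
have -> : J *m v = v - const_mx (N%:R^-1 * \sum_j v j ord0).
  by apply/matrixP => i j; rewrite (ord1 j) JN_mulE !mxE.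
by rewrite mulmxBr laplacian_const subr0.
Qed.

Lemma JN_laplacian (adj_sym : symmetric adj) (v : 'cV[R]_N) : J *m (L *m v) = L *m v.
Proof.
apply/matrixP => i j; rewrite (ord1 j) JN_mulE.
suff -> : \sum_j (L *m v) j ord0 = 0 by rewrite mulr0 subr0.
under eq_bigr => k _ do rewrite laplacian_mulE.
have sw : \sum_i \sum_(j | adj i j) (v i ord0 - v j ord0) =
    \sum_i \sum_(j | adj i j) (v j ord0 - v i ord0).
  rewrite (exchange_big_dep xpredT) //=; apply: eq_bigr => k _.
  by apply: eq_bigl => l; rewrite adj_sym.
apply/eqP; rewrite -[_ == 0](mulrn_eq0 _ 2) /= mulr2n {2}sw -big_split /= big1 //.
by move=> k _; rewrite -big_split /= big1 // => l _; rewrite addrC subrKA subrr.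
Qed.

Lemma connected_has_edge : (2 <= N)%N -> (forall i j, connect adj i j) ->
  exists i j, adj i j.
Proof.
move=> hN conn; have /connectP[[|k p] /=] := conn (Ordinal (ltnW hN)) (Ordinal hN).
  by move=> _ [].
by case/andP => ? _ _; exists (Ordinal (ltnW hN)), k.
Qed.

(** This constant is a divisor in [alpha] and in a Young weight. The test vector is the unit vector
    of one edge, whose image under [J *m W] has the entry [1 - 1 / N]. *)
Lemma lambdaG_gt0 : (2 <= N)%N -> (forall i j, connect adj i j) -> 0 < lambdaG R adj.
Proof.
move=> hN conn; have [i [j aij]] := connected_has_edge hN conn.
have [p pE] := pair_of_surj aij.
pose e : 'cV[R]_(npairs adj) := delta_mx p ord0.
have e1 : sqnorm e = 1.
  rewrite /sqnorm (bigD1 p) //= big1 ?addr0 => [|q qp]; rewrite mxE.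
    by rewrite !eqxx expr1n.
  by rewrite (negPf qp) expr0n.
have Je : (J *m W *m e) i ord0 = 1 - N%:R^-1.
  rewrite -mulmxA JN_mulE /e -colE !mxE pE eqxx; congr (_ - _).
  rewrite (bigD1 i) //= !mxE pE eqxx big1 ?addr0 ?mulr1 // => k ki.
  by rewrite !mxE pE eq_sym (negPf ki).
have N1 : 0 < 1 - N%:R^-1 :> R.
  by rewrite subr_gt0 invf_lt1 ?ltr0n ?ltr1n // (ltn_trans _ hN).
have : (1 - N%:R^-1) ^+ 2 <= lambdaG R adj.
  rewrite -Je; apply: le_trans (sqr_le_sqnorm _ _) _.
  by apply: opnorm2_ge; rewrite e1.
by apply: lt_le_trans; rewrite exprn_gt0.
Qed.

End GraphMatrices.

Section OneStepBounds.
Variables (R : realType) (N : nat) (adj : rel 'I_N).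
Local Notation W := (Wmx R adj).
Local Notation Q := (Qmx R adj).
Local Notation J := (JN R N).
Local Notation L := (laplacian R adj).
Local Notation lG := (lambdaG R adj).
Local Notation lQW := (lambdaQW R adj).
Local Notation lQL := (lambdaQL R adj).
Variables (l2 : R).
Hypotheses (l2_gt0 : 0 < l2) (lG_gt0 : 0 < lG).
Hypothesis gap : forall v : 'cV[R]_N, \sum_i v i ord0 = 0 ->
    l2 * sqnorm v <= dot v (L *m v).

Definition consensus_const (cV cE : R) : R := 2 * (lG * cE) + 2 * (opnorm2 L * cV).

(** The gap yields dissipation [2 * g * l2]; Young with weight [l2] spends half of it on the cross
    term with [e]. The squared increment is only bounded, as it carries the factor [g ^+ 2]. *)
Lemma consensus_step (g cV cE : R) (x : 'cV[R]_N) (e : 'cV[R]_(npairs adj)) :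
  0 <= g -> \sum_i x i ord0 = 0 -> sqnorm x <= cV -> sqnorm e <= cE ->
  sqnorm (x + g *: (J *m W *m e - L *m x)) <=
    (1 - g * l2) * sqnorm x + g * (lG / l2) * sqnorm e
    + g ^+ 2 * consensus_const cV cE.
Proof.
move=> g0 sx xV eE; rewrite sqnormD dotZr sqnormZ.
have gx := gap sx.
have y1 : 2 * dot x (J *m W *m e) <= l2 * sqnorm x + lG / l2 * sqnorm e.
  apply: le_trans (young_dot x (J *m W *m e) l2_gt0) _.
  rewrite lerD2l mulrAC mulrC -[leRHS]mulrC mulrC ler_wpM2l ?invr_ge0 ?(ltW l2_gt0) //.
  exact: sqnorm_mulmx_le.
have q1 : sqnorm (J *m W *m e - L *m x) <= consensus_const cV cE.
  apply: le_trans (sqnormD_le2 _ _) _; rewrite sqnormN /consensus_const.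
  apply: lerD; rewrite ler_pM2l //.
    apply: le_trans (sqnorm_mulmx_le _ _) _.
    by rewrite ler_wpM2l // ltW.
  apply: le_trans (sqnorm_mulmx_le _ _) _.
  by rewrite ler_wpM2l // opnorm2_ge0.
rewrite dotBr.
have := ler_wpM2l (sqr_ge0 g) q1.
have := ler_wpM2l g0 y1; have := ler_wpM2l g0 gx.
by lra.
Qed.

Definition estimation_rate : R := 2 * Num.sqrt lQW + lQL * l2 / lG.

Definition estimation_const (cV cE : R) : R := 2 * (lQW * cE) + 2 * (lQL * cV).

Lemma estimation_step (g cV cE : R) (x : 'cV[R]_N) (e : 'cV[R]_(npairs adj)) :
  0 <= g -> sqnorm x <= cV -> sqnorm e <= cE ->
  sqnorm (e - g *: (Q *m (W *m e - L *m x))) <=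
    (1 + g * estimation_rate) * sqnorm e + g * (lG / l2) * sqnorm x
    + g ^+ 2 * estimation_const cV cE.
Proof.
move=> g0 xV eE; rewrite -scaleNr sqnormD dotZr sqnormZ sqrrN.
rewrite mulmxBr !mulmxA dotBr.
have lQW0 : 0 <= lQW by exact: opnorm2_ge0.
have lQL0 : 0 <= lQL by exact: opnorm2_ge0.
have bW : sqnorm (Q *m W *m e) <= lQW * sqnorm e by exact: sqnorm_mulmx_le.
have bL : sqnorm (Q *m L *m x) <= lQL * sqnorm x by exact: sqnorm_mulmx_le.
have y1 : - (2 * dot e (Q *m W *m e)) <= 2 * Num.sqrt lQW * sqnorm e.
  have -> : - (2 * dot e (Q *m W *m e)) = 2 * dot e (- (Q *m W *m e)).
    by rewrite dotNr mulrN.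
  (* With weight [Num.sqrt lQW], Young loses nothing against Cauchy-Schwarz; a zero weight has to be
     treated apart. *)
  have [z|nz] := eqVneq lQW 0.
    move: bW; rewrite z mul0r => /sqnorm_eq0 ->.
    by rewrite oppr0 dot0r sqrtr0 !mulr0 mul0r.
  have s0 : 0 < Num.sqrt lQW by rewrite sqrtr_gt0 lt_def nz.
  apply: le_trans (young_dot _ _ s0) _; rewrite sqnormN.
  suff : (Num.sqrt lQW)^-1 * sqnorm (Q *m W *m e) <= Num.sqrt lQW * sqnorm e by lra.
  by rewrite ler_pdivrMl // mulrA -expr2 sqr_sqrtr.
(* The weight [l2 / lG] makes the coefficient of [sqnorm x] equal to the coupling [lG / l2] of
   [consensus_step]. *)
have y2 : 2 * dot e (Q *m L *m x) <= lQL * l2 / lG * sqnorm e + lG / l2 * sqnorm x.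
  have := @young_dot_bound _ _ lQL (l2 / lG) (sqnorm x) e (Q *m L *m x) lQL0
    (divr_gt0 l2_gt0 lG_gt0) (sqnorm_ge0 x) bL.
  by rewrite invf_div mulrA.
have q1 : sqnorm (Q *m W *m e - Q *m L *m x) <= estimation_const cV cE.
  apply: le_trans (sqnormD_le2 _ _) _; rewrite sqnormN /estimation_const.
  apply: lerD; rewrite ler_pM2l //.
    by apply: le_trans bW _; rewrite ler_wpM2l.
  by apply: le_trans bL _; rewrite ler_wpM2l.
have := ler_wpM2l (sqr_ge0 g) q1.
have := ler_wpM2l g0 y1; have := ler_wpM2l g0 y2.
by rewrite /estimation_rate; lra.
Qed.

End OneStepBounds.

(** * The compressed output as an integrator *)

Section ClosedLoop.
Variables (R : realType) (n : nat).

Lemma bext0 (b : 'I_n.-1 -> R) : (0 < n)%N -> bext b 0 = 0.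
Proof. by rewrite /bext; case: n b. Qed.

Lemma bextn (b : 'I_n.-1 -> R) : bext b n = 1.
Proof. by rewrite /bext eqxx. Qed.

Lemma K2_Amx (a : 'I_n -> R) (b : 'I_n.-1 -> R) :
  K2 b *m Amx a = \row_l (bext b l + a l).
Proof.
apply/rowP => l; rewrite !mxE; under eq_bigr => k _ do rewrite !mxE.
have n0 : (0 < n)%N by case: n l => [[]|].
have last_lt : (n.-1 < n)%N by rewrite prednK.
rewrite (bigD1 (Ordinal last_lt)) //= prednK // ltnn bextn mul1r addrC; congr (_ + _).
have lastP (k : 'I_n) : k != Ordinal last_lt -> (k.+1 < n)%N.
  rewrite ltn_neqAle ltn_ord andbT => ne; apply: contraNneq ne => e.
  by rewrite -val_eqE /= -[X in X == _]succnK e.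
have [l0|l0] := posnP l.
  by rewrite l0 bext0 // big1 // => k /lastP ->; rewrite mulr0.
have l1 : (l.-1 < n)%N by rewrite (leq_ltn_trans (leq_pred _)).
rewrite (bigD1 (Ordinal l1)) /=; last first.
  by rewrite -val_eqE /= neq_ltn -ltnS !prednK // ltn_ord.
rewrite prednK // ltn_ord eqxx mulr1 big1 ?addr0 // => k /andP[/lastP -> kl].
case: eqP => [lk|]; last by rewrite mulr0.
by move: kl; rewrite -val_eqE /= lk eqxx.
Qed.

Lemma K2_Bvec (b : 'I_n.-1 -> R) : (0 < n)%N -> sc (K2 b *m Bvec R n) = 1.
Proof.
move=> n0; have last_lt : (n.-1 < n)%N by rewrite prednK.
rewrite /sc mxE (bigD1 (Ordinal last_lt)) //= !mxE /= prednK // eqxx bextn mulr1.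
rewrite big1 ?addr0 // => k; rewrite -val_eqE /= => kn; rewrite !mxE.
case: eqP => [e|]; last by rewrite mulr0.
by move: kn; rewrite -[X in X != _]succnK e eqxx.
Qed.

Lemma scD (x y : 'M[R]_1) : sc (x + y) = sc x + sc y.
Proof. by rewrite /sc mxE. Qed.

Lemma scZ (k : R) (x : 'M[R]_1) : sc (k *: x) = k * sc x.
Proof. by rewrite /sc mxE. Qed.

(** The gain [K1] is designed so that [K2 A + K1 = K2], and [K2 B = 1]: whatever [a] is, the output
    only accumulates the consensus term [v]. *)
Lemma K2_closed_loop (a : 'I_n -> R) (b : 'I_n.-1 -> R) (x : 'cV[R]_n) (v : R) :
  (0 < n)%N ->
  sc (K2 b *m (Amx a *m x + (sc (K1 a b *m x) + v) *: Bvec R n)) = sc (K2 b *m x) + v.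
Proof.
move=> n0; rewrite mulmxDr -scalemxAr scD scZ K2_Bvec // mulr1 mulmxA K2_Amx addrA -scD.
rewrite -mulmxDl; congr (sc (_ *m _) + _); apply/rowP => l; rewrite !mxE; ring.
Qed.

End ClosedLoop.

(** * Vector form of the output dynamics and invariance of the bounds *)

Section StateBounds.
Variables (R : realType) (n N : nat) (adj : rel 'I_N).
Variables (a : 'I_n -> R) (b : 'I_n.-1 -> R) (c : 'I_N -> 'I_N -> R).
Variables (sigma beta gamma M : R) (t0 : nat).
Hypotheses (n_gt0 : (0 < n)%N) (M_gt0 : 0 < M) (gamma_gt0 : 0 < gamma).
Hypotheses (ht0 : gamma * (dmax adj)%:R - 1 < t0%:R).

Local Notation state := (state R n N).
Local Notation output := (output b).
Local Notation bit_step := (bit_step adj a b c sigma beta gamma M).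
Local Notation W := (Wmx R adj).
Local Notation Q := (Qmx R adj).
Local Notation J := (JN R N).
Local Notation L := (laplacian R adj).

Definition outputs (st : state) : 'cV[R]_N := \col_i output st i.
Definition estimates (st : state) : 'cV[R]_(npairs adj) :=
  \col_p st.2 (pair_of p).1 (pair_of p).2.
Definition consensus_error (st : state) : 'cV[R]_N := J *m outputs st.
Definition estimation_error (st : state) : 'cV[R]_(npairs adj) :=
  estimates st - Q *m outputs st.

Lemma output_bit_step t st sb i : output (bit_step t st sb) i = output st i +
  gamma / t.+1%:R * \sum_(j in nbrs adj i) ((bit_step t st sb).2 i j - output st i).
Proof. exact: K2_closed_loop. Qed.

(** Inserting the true output of the neighbour splits each difference into an estimation error,
    summed by [W], and a disagreement, summed by [L]. The error compares new estimates with old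
    outputs. *)
Lemma outputs_bit_step t st sb (e := estimates (bit_step t st sb) - Q *m outputs st) :
  outputs (bit_step t st sb) =
  outputs st + (gamma / t.+1%:R) *: (W *m e - L *m outputs st).
Proof.
apply/matrixP => i k; rewrite (ord1 k) [LHS]mxE output_bit_step.
rewrite mxE [outputs st i ord0]mxE [(_ *: _ : 'cV_N) _ _]mxE; congr (_ + _ * _).
rewrite [RHS]mxE [(- _ : 'cV_N) _ _]mxE laplacian_mulE.
have -> : e = \col_p ((bit_step t st sb).2 (pair_of p).1 (pair_of p).2 - output st (pair_of p).2).
  by apply/matrixP => p q; rewrite (ord1 q) /e mxE [(- _ : 'cV_(npairs adj)) _ _]mxE Qmx_mulE !mxE.
rewrite (Wmx_mulE adj (fun i j => (bit_step t st sb).2 i j - output st j)).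
rewrite [X in _ - X](eq_bigl (fun j => j \in nbrs adj i)); last by move=> j; rewrite inE.
by rewrite -sumrB; apply: eq_bigr => j _; rewrite !mxE; ring.
Qed.

Definition bounded_state (st : state) : Prop :=
  (forall i, `|output st i| <= M) /\ (forall i j, adj i j -> `|st.2 i j| <= M).

Lemma projM_bounded x : `|projM M x| <= M.
Proof.
rewrite /projM ler_norml; apply/andP; split; first by rewrite le_max lexx.
rewrite ge_max ge_min lexx /= andbT.
by rewrite ge0_cp // ltW.
Qed.

Lemma projM_contract x y : `|y| <= M -> (projM M x - y) ^+ 2 <= (x - y) ^+ 2.
Proof.
rewrite ler_norml /projM => /andP[y1 y2].
have [Mx|xM] := leP M x.
  by rewrite max_r; nra.
have [xM'|Mx'] := leP x (- M).
  by nra.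
by [].
Qed.

(** The new output is a convex combination of the old output and the projected estimates, because
    the gain times the degree is at most 1; this is where the lower bound on [t0] enters. *)
Lemma bounded_bit_step k st sb : bounded_state st ->
  bounded_state (bit_step (t0 + k).+1 st sb).
Proof.
case=> ob eb; set t := (t0 + k).+1.
have eb' i j : adj i j -> `|(bit_step t st sb).2 i j| <= M.
  by move=> aij /=; rewrite aij; exact: projM_bounded.
split => // i; rewrite output_bit_step.
set g := gamma / t.+1%:R.
have tp : (0 : R) < t.+1%:R by rewrite ltr0n.
have g0 : 0 <= g by rewrite divr_ge0 // ltW.
have gd : g * #|nbrs adj i|%:R <= 1.
  rewrite /g mulrAC ler_pdivrMr // mul1r.
  apply: le_trans (_ : gamma * (dmax adj)%:R <= _).
    rewrite ler_pM2l // ler_nat; exact: (leq_bigmax i).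
  apply: le_trans (_ : t0%:R + 1 <= _); first by move: ht0; lra.
  by rewrite natr1 ler_nat /t ltnS (leq_trans (leq_addr k t0)).
clearbody g.
have -> : output st i + g * \sum_(j in nbrs adj i) ((bit_step t st sb).2 i j - output st i)
  = (1 - g * #|nbrs adj i|%:R) * output st i + g * \sum_(j in nbrs adj i) (bit_step t st sb).2 i j.
  by rewrite sumrB sumr_const -[output st i *+ _]mulr_natl; ring.
apply: le_trans (ler_normD _ _) _; rewrite !normrM (ger0_norm g0).
rewrite (@ger0_norm _ (1 - _)) ?subr_ge0 //.
have s1 : `|\sum_(j in nbrs adj i) (bit_step t st sb).2 i j| <= #|nbrs adj i|%:R * M.
  apply: le_trans (ler_norm_sum _ _ _) _.
  rewrite mulr_natl -sumr_const; apply: ler_sum => j; rewrite inE; exact: eb'.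
have := ler_wpM2l g0 s1.
have := ob i; have : 0 <= 1 - g * #|nbrs adj i|%:R by rewrite subr_ge0.
by move=> /ler_wpM2l h /h; lra.
Qed.

Lemma sqr_le_sqr (x y : R) : `|x| <= y -> x ^+ 2 <= y ^+ 2.
Proof. by move=> xy; rewrite -real_normK ?num_real // ler_sqr ?nnegrE // (le_trans _ xy). Qed.

Definition output_bound : R := opnorm2 J * (N%:R * M ^+ 2).
Definition error_bound : R := (npairs adj)%:R * (2 * M) ^+ 2.

Lemma consensus_error_bound st : bounded_state st ->
  sqnorm (consensus_error st) <= output_bound.
Proof.
case=> ob _; apply: le_trans (sqnorm_mulmx_le _ _) _.
rewrite ler_wpM2l ?opnorm2_ge0 // /sqnorm mulr_natl -[X in _ *+ X](card_ord N) -sumr_const.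
by apply: ler_sum => i _; rewrite mxE; exact: sqr_le_sqr.
Qed.

Lemma estimate_error_bound st st' : bounded_state st -> bounded_state st' ->
  sqnorm (estimates st' - Q *m outputs st) <= error_bound.
Proof.
case=> ob _ [_ eb]; rewrite /sqnorm /error_bound mulr_natl.
rewrite -[X in _ *+ X](card_ord (npairs adj)) -sumr_const; apply: ler_sum => p _.
rewrite mxE [(- _ : 'cV_(npairs adj)) _ _]mxE Qmx_mulE !mxE; apply: sqr_le_sqr.
apply: le_trans (ler_normB _ _) _; rewrite mulr2n mulrDl mul1r lerD //.
by apply: eb; exact: pair_ofP.
Qed.

End StateBounds.

(** * Mean drift of the Lyapunov function *)

Section Drift.
Variables (R : realType) (n N : nat) (adj : rel 'I_N).
Variables (a : 'I_n -> R) (b : 'I_n.-1 -> R) (c : 'I_N -> 'I_N -> R).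
Variables (sigma beta gamma M : R) (t0 : nat).
Hypotheses (n_gt0 : (0 < n)%N) (M_gt0 : 0 < M) (gamma_gt0 : 0 < gamma).
Hypotheses (ht0 : gamma * (dmax adj)%:R - 1 < t0%:R).

Local Notation state := (state R n N).
Local Notation bit_step := (bit_step adj a b c sigma beta gamma M).
Local Notation bits_prob := (bits_prob adj b c sigma).
Local Notation transition := (transition adj a b c sigma beta gamma M t0).
Local Notation expect := (expect adj a b c sigma beta gamma M t0).
Local Notation bounded_state := (bounded_state adj b M).
Local Notation W := (Wmx R adj).
Local Notation Q := (Qmx R adj).
Local Notation J := (JN R N).
Local Notation L := (laplacian R adj).
Local Notation outputs := (outputs b).
Local Notation estimates := (estimates adj).
Local Notation consensus_error := (consensus_error b).
Local Notation estimation_error := (estimation_error adj b).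

(** Comparison on bounded states suffices, as they are invariant; the drift estimate is available
    only there. *)
Lemma expect_le m k st (phi psi : state -> R) : bounded_state st ->
  (forall s, bounded_state s -> phi s <= psi s) -> expect m k st phi <= expect m k st psi.
Proof.
move=> + le; elim: m k st => [|m IH] k st bst; first exact: le.
apply: ler_sum => sb _; rewrite ler_wpM2l ?bits_prob_ge0 //.
by apply: IH; exact: bounded_bit_step.
Qed.

Lemma expect_lin m k st (x y : R) (phi psi : state -> R) :
  expect m k st (fun s => x * phi s + y * psi s) =
  x * expect m k st phi + y * expect m k st psi.
Proof.
elim: m k st => [//|m IH] k st /=.
rewrite !mulr_sumr -big_split; apply: eq_bigr => sb _ /=.
by rewrite IH; ring.
Qed.

Lemma expect_cst m k st (x : R) : expect m k st (fun=> x) = x.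
Proof.
elim: m k st => [//|m IH] k st /=.
by under eq_bigr => sb _ do rewrite IH; rewrite -mulr_suml sum_bits_prob mul1r.
Qed.

Hypotheses (sigma_gt0 : 0 < sigma) (beta_gt0 : 0 < beta).
Variable fM : R.
Hypotheses (fM_ge0 : 0 <= fM)
  (fM_le : forall i j, adj i j -> fM <= gaussf sigma (`|c i j| + M)).

(* The projection is nonexpansive towards the true output and the mean bit is
   F(c - z), so the estimation error contracts at rate at least 2 beta f_M / t. *)
Lemma mean_estimation_error t st : (0 < t)%N -> bounded_state st ->
  \sum_sb bits_prob st sb * sqnorm (estimates (bit_step t st sb) - Q *m outputs st) <=
  (1 - 2 * beta * fM / t%:R) * sqnorm (estimation_error st)
  + (npairs adj)%:R * beta ^+ 2 / t%:R ^+ 2.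
Proof.
move=> t_gt0 [ob eb]; set h : R := t%:R^-1.
have h0 : 0 < h by rewrite invr_gt0 ltr0n.
have -> : (npairs adj)%:R * beta ^+ 2 / t%:R ^+ 2 =
    \sum_(p < npairs adj) (beta * h) ^+ 2.
  by rewrite sumr_const card_ord -mulrA mulr_natl exprMn /h exprVn.
rewrite /sqnorm; under eq_bigr => sb _ do rewrite mulr_sumr.
rewrite exchange_big /= mulr_sumr -big_split /=; apply: ler_sum => p _.
set i := (pair_of p).1; set j := (pair_of p).2.
have aij : adj i j by exact: pair_ofP.
rewrite [estimation_error _ _ _]mxE [(- _ : 'cV_(npairs adj)) _ _]mxE Qmx_mulE.
rewrite [estimates st p _]mxE [outputs st _ _]mxE -/i -/j.
set z := output b st j; set e := st.2 i j - z.
set F1 := gaussF sigma (c i j - st.2 i j).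
have F10 : 0 <= F1 by exact: gaussF_ge0.
have F11 : F1 <= 1 by exact: gaussF_le1.
have pt sb : (estimates (bit_step t st sb) - Q *m outputs st) p ord0 ^+ 2 <=
   e ^+ 2 + 2 * beta * h * e * F1 + (beta * h) ^+ 2
   - 2 * beta * h * e * ((i, j) \in sb)%:R.
  rewrite mxE [(- _ : 'cV_(npairs adj)) _ _]mxE Qmx_mulE [outputs st _ _]mxE.
  rewrite [estimates _ p _]mxE -/i -/j /= aij -/z -/F1.
  apply: le_trans (projM_contract _ (ob j)) _; rewrite -/z.
  set s : R := ((i, j) \in sb)%:R.
  have -> : st.2 i j + beta * h * (F1 - s) - z = e + beta * h * (F1 - s) by rewrite /e; ring.
  have s1 : (F1 - s) ^+ 2 <= 1.
    by rewrite /s; case: (_ \in _) => /=; [|rewrite subr0]; nra.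
  have := ler_wpM2l (sqr_ge0 (beta * h)) s1.
  by rewrite sqrrD exprMn; lra.
apply: le_trans (_ : \sum_sb bits_prob st sb * (e ^+ 2 + 2 * beta * h * e * F1
   + (beta * h) ^+ 2 - 2 * beta * h * e * ((i, j) \in sb)%:R) <= _).
  by apply: ler_sum => sb _; rewrite ler_wpM2l ?bits_prob_ge0.
under eq_bigr => sb _ do rewrite mulrBr mulrCA.
rewrite sumrB -mulr_suml -mulr_sumr sum_bits_prob mean_bit mul1r.
rewrite /bit_prob /= aij -/z; set F2 := gaussF sigma (c i j - z).
have nb (x : R) : `|x| <= M -> `|c i j - x| <= `|c i j| + M.
  by move=> xM; apply: le_trans (ler_normB _ _) _; rewrite lerD2l.
have := gaussF_monotone_gap sigma_gt0 (nb _ (eb _ _ aij)) (nb _ (ob j)).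
rewrite -/F1 -/z -/F2.
have -> : c i j - st.2 i j - (c i j - z) = - e by rewrite /e; ring.
rewrite sqrrN => gp.
have gp2 : fM * e ^+ 2 <= - e * (F1 - F2).
  by apply: le_trans gp; rewrite ler_wpM2r ?sqr_ge0 // fM_le.
have bh : 0 <= 2 * (beta * h) by rewrite mulr_ge0 // mulr_ge0 // ltW.
have := ler_wpM2l bh gp2.
by lra.
Qed.

Hypotheses (adj_sym : symmetric adj) (N_gt0 : (0 < N)%N).
Variable l2 : R.
Hypotheses (l2_gt0 : 0 < l2) (lG_gt0 : 0 < lambdaG R adj).
Hypothesis gap : forall v : 'cV[R]_N, \sum_i v i ord0 = 0 ->
    l2 * sqnorm v <= dot v (L *m v).
Local Notation lG := (lambdaG R adj).
Local Notation alpha := (estimation_rate adj l2).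

Definition lyapunov (u v : R) (st : state) : R :=
  u * sqnorm (consensus_error st) + v * sqnorm (estimation_error st).

Lemma lyapunov_drift (u v rho : R) : 0 <= u -> 0 <= v ->
  rho * u <= gamma * l2 * u - gamma * (lG / l2) * v ->
  rho * v <= (2 * beta * fM - gamma * alpha) * v - gamma * (lG / l2) * u ->
  exists2 C, 0 <= C & forall k st, bounded_state st ->
    transition k (lyapunov u v) st <=
    (1 - rho / (t0 + 1 + k)%:R) * lyapunov u v st + C / (t0 + 1 + k)%:R ^+ 2.
Proof.
move=> u0 v0 hu hv; set kap := lG / l2 in hu hv *.
pose cV := output_bound N M; pose cE := error_bound adj M.
pose D : R := (npairs adj)%:R * beta ^+ 2.
pose C1 := consensus_const adj cV cE; pose C2 := estimation_const adj cV cE.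
have kap0 : 0 <= kap by rewrite divr_ge0 // ltW.
have al0 : 0 <= alpha.
  rewrite /estimation_rate addr_ge0 ?mulr_ge0 ?sqrtr_ge0 //.
  - exact: opnorm2_ge0.
  - exact: ltW.
  - by rewrite invr_ge0 ltW.
have cV0 : 0 <= cV.
  by rewrite /cV /output_bound mulr_ge0 ?opnorm2_ge0 // mulr_ge0 ?sqr_ge0.
have cE0 : 0 <= cE by rewrite /cE /error_bound mulr_ge0 ?sqr_ge0.
have D0 : 0 <= D by rewrite mulr_ge0 ?sqr_ge0.
have C10 : 0 <= C1.
  by rewrite /C1 /consensus_const addr_ge0 // mulr_ge0 // mulr_ge0 // ?opnorm2_ge0 // ltW.
have C20 : 0 <= C2.
  by rewrite /C2 /estimation_const addr_ge0 // mulr_ge0 // mulr_ge0 // opnorm2_ge0.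
have ga0 := ltW gamma_gt0.
exists (u * (gamma * l2 * cV + gamma * kap * D + gamma ^+ 2 * C1)
      + v * (D + gamma * alpha * D + gamma ^+ 2 * C2)).
  have l20 := ltW l2_gt0; have ga2 := sqr_ge0 gamma.
  by apply: addr_ge0; apply: mulr_ge0 => //; repeat apply: addr_ge0 => //;
    repeat apply: mulr_ge0 => //.
move=> k st bst; have -> : (t0 + 1 + k)%N = (t0 + k).+1 by rewrite addn1 addSn.
set t := (t0 + k).+1; set g := gamma / t.+1%:R; set h : R := t%:R^-1.
have tp : (0 : R) < t%:R by rewrite ltr0n.
have h0 : 0 < h by rewrite invr_gt0.
have h1 : h <= 1 by rewrite invf_le1 // ler1n.
(* The gain is [gamma / (t + 1)] while rates are counted in [h = 1 / t]. The dissipative term uses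
   the lower bound [gh2], the others the upper bound [gh]; the gap [gamma * h ^+ 2] is charged to
   the constant through [l2 * cV]. *)
have gE : g = gamma * h - gamma * (h * t.+1%:R^-1).
  by rewrite /g /h -natr1; field; lra.
have t1h : t.+1%:R^-1 <= h by rewrite lef_pV2 ?posrE // ler_nat.
have t1p : (0 : R) < t.+1%:R^-1 by rewrite invr_gt0.
have g0 : 0 <= g by rewrite divr_ge0.
have gh : g <= gamma * h by rewrite /g ler_wpM2l.
have gh2 : gamma * h - gamma * h ^+ 2 <= g.
  by rewrite gE lerD2l lerN2 ler_wpM2l // expr2 ler_wpM2l // ltW.
set V := sqnorm (consensus_error st); set Rr := sqnorm (estimation_error st).
have V0 : 0 <= V by exact: sqnorm_ge0.
have R0 : 0 <= Rr by exact: sqnorm_ge0.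
have VcV : V <= cV by exact: (consensus_error_bound bst).
pose e sb := estimates (bit_step t st sb) - Q *m outputs st.
pose E := \sum_sb bits_prob st sb * sqnorm (e sb).
have E0 : 0 <= E.
  by apply: sumr_ge0 => sb _; rewrite mulr_ge0 ?bits_prob_ge0 ?sqnorm_ge0.
have EE : E <= (1 - 2 * beta * fM * h) * Rr + D * h ^+ 2.
  by have := mean_estimation_error (ltn0Sn _ : (0 < t)%N) bst; rewrite /D /h exprVn.
have ER : E <= Rr + D * h ^+ 2.
  apply: le_trans EE _; rewrite lerD2r ler_piMl // lerBlDr lerDl.
  by rewrite !mulr_ge0 // ltW.
have sV : \sum_i consensus_error st i ord0 = 0 by exact: sum_JN.
have eE sb : sqnorm (e sb) <= cE.
  by apply: (estimate_error_bound bst); exact: bounded_bit_step.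
have nextV sb : sqnorm (consensus_error (bit_step t st sb)) <=
    (1 - g * l2) * V + g * kap * sqnorm (e sb) + g ^+ 2 * C1.
  rewrite /consensus_error (outputs_bit_step _ _ _ _ _ _ _ _ n_gt0) -/(e sb) -/g.
  rewrite mulmxDr -scalemxAr mulmxBr JN_laplacian // -laplacian_JN.
  rewrite [J *m (W *m _)]mulmxA -/(consensus_error st).
  exact: (consensus_step l2_gt0 lG_gt0 gap g0 sV VcV (eE sb)).
have nextR sb : sqnorm (estimation_error (bit_step t st sb)) <=
    (1 + g * alpha) * sqnorm (e sb) + g * kap * V + g ^+ 2 * C2.
  rewrite /estimation_error (outputs_bit_step _ _ _ _ _ _ _ _ n_gt0) -/(e sb) -/g.
  rewrite mulmxDr opprD addrA -/(e sb) -scalemxAr -laplacian_JN.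
  exact: (estimation_step l2_gt0 lG_gt0 g0 VcV (eE sb)).
(* Both one-step bounds are affine in [sqnorm (e sb)], so averaging over the bits just replaces it
   by [E]. *)
have step1 : transition k (lyapunov u v) st <=
    u * ((1 - g * l2) * V + g * kap * E + g ^+ 2 * C1)
    + v * ((1 + g * alpha) * E + g * kap * V + g ^+ 2 * C2).
  apply: le_trans (_ : \sum_sb bits_prob st sb *
    (u * ((1 - g * l2) * V + g * kap * sqnorm (e sb) + g ^+ 2 * C1)
    + v * ((1 + g * alpha) * sqnorm (e sb) + g * kap * V + g ^+ 2 * C2)) <= _).
    apply: ler_sum => sb _; rewrite ler_wpM2l ?bits_prob_ge0 //.
    by apply: lerD; rewrite ler_wpM2l.
  apply: ler_eq; pose A := u * ((1 - g * l2) * V + g ^+ 2 * C1)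
    + v * (g * kap * V + g ^+ 2 * C2).
  pose B := u * (g * kap) + v * (1 + g * alpha).
  transitivity (\sum_sb (bits_prob st sb * A + bits_prob st sb * sqnorm (e sb) * B)).
    by apply: eq_bigr => sb _; rewrite /A /B; ring.
  by rewrite big_split /= -!mulr_suml sum_bits_prob -/E /A /B; ring.
apply: le_trans step1 _; rewrite /lyapunov -/V -/Rr.
have gg : g ^+ 2 <= gamma ^+ 2 * h ^+ 2.
  by rewrite -exprMn ler_sqr ?nnegrE // mulr_ge0 // ltW.
have i1 : - (g * l2 * V) <= - (gamma * h * l2 * V) + gamma * l2 * cV * h ^+ 2.
  have w0 : 0 <= l2 * V by rewrite mulr_ge0 // ltW.
  have := ler_wpM2r w0 gh2.
  have : 0 <= gamma * l2 * h ^+ 2 by rewrite !mulr_ge0 ?sqr_ge0 // ltW.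
  by move=> /ler_wpM2l/(_ _ _ VcV); lra.
have i2 : g * E <= gamma * h * Rr + gamma * D * h ^+ 2.
  apply: le_trans (_ : gamma * h * (Rr + D * h ^+ 2) <= _).
    by apply: ler_pM.
  have : gamma * D * h ^+ 2 * h <= gamma * D * h ^+ 2 * 1.
    by apply: ler_wpM2l => //; rewrite mulr_ge0 ?sqr_ge0 // mulr_ge0.
  by lra.
have i3 : g * V <= gamma * h * V by rewrite ler_wpM2r.
have i4 : g ^+ 2 * C1 <= gamma ^+ 2 * h ^+ 2 * C1 by rewrite ler_wpM2r.
have i5 : g ^+ 2 * C2 <= gamma ^+ 2 * h ^+ 2 * C2 by rewrite ler_wpM2r.
have j1 : (1 - g * l2) * V + g * kap * E + g ^+ 2 * C1 <=
   V - gamma * h * l2 * V + gamma * h * kap * Rr +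
   (gamma * l2 * cV + gamma * kap * D + gamma ^+ 2 * C1) * h ^+ 2.
  by have := ler_wpM2l kap0 i2; lra.
have j2 : (1 + g * alpha) * E + g * kap * V + g ^+ 2 * C2 <=
   Rr - 2 * beta * fM * h * Rr + gamma * h * alpha * Rr + gamma * h * kap * V +
   (D + gamma * alpha * D + gamma ^+ 2 * C2) * h ^+ 2.
  by have := ler_wpM2l al0 i2; have := ler_wpM2l kap0 i3; lra.
have hV : 0 <= h * V by rewrite mulr_ge0 // ltW.
have hR : 0 <= h * Rr by rewrite mulr_ge0 // ltW.
have := ler_wpM2l hV hu; have := ler_wpM2l hR hv.
have := ler_wpM2l u0 j1; have := ler_wpM2l v0 j2.
by rewrite -exprVn -/h; lra.
Qed.

End Drift.

(** * From outputs to states *)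

Section ComplexModulus.
Variable R : realType.

(** The squared modulus kept as an element of [R], so that [expect] can average it. *)
Definition csq (z : R[i]) : R := complex.Re z ^+ 2 + complex.Im z ^+ 2.

Lemma csq_ge0 z : 0 <= csq z.
Proof. by rewrite addr_ge0 ?sqr_ge0. Qed.

Lemma csqM x y : csq (x * y) = csq x * csq y.
Proof. by case: x => ? ?; case: y => ? ?; rewrite /csq /=; ring. Qed.

Lemma csqD_le (t : R) x y : 0 < t -> csq (x + y) <= (1 + t) * csq x + (1 + t^-1) * csq y.
Proof.
have yg (p q : R) : 0 < t -> (p + q) ^+ 2 <= (1 + t) * p ^+ 2 + (1 + t^-1) * q ^+ 2.
  move=> t0; rewrite -subr_ge0.
  have -> : (1 + t) * p ^+ 2 + (1 + t^-1) * q ^+ 2 - (p + q) ^+ 2 = (t * p - q) ^+ 2 / t.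
    by field; lra.
  by rewrite divr_ge0 ?sqr_ge0 // ltW.
move=> t0; case: x => p q; case: y => p' q'; rewrite /csq /=.
by have := yg p p' t0; have := yg q q' t0; lra.
Qed.

Lemma csq_real (x : R) : csq (real_complex R x) = x ^+ 2.
Proof. by rewrite /csq /= expr0n addr0. Qed.

Lemma csq_lt1 (z : R[i]) : `|z| < 1 -> csq z < 1.
Proof.
rewrite normc_def -(rmorph1 (real_complex R)) /= ltcR -/(csq z) => h.
rewrite -(sqr_sqrtr (csq_ge0 z)) expr_lt1 ?sqrtr_ge0 //.
Qed.

End ComplexModulus.

Section ShiftPairing.
Variables (R : realType) (n : nat).
Local Notation toC := (real_complex R).

(** Reads a polynomial of size at most [n] as a linear functional on states, so that advancing time
    becomes multiplication by ['X]. *)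
Definition pairing (q : {poly R[i]}) (e : 'cV[R]_n) : R[i] :=
  \sum_(l < n) q`_l * toC (e l ord0).

Lemma pairingD p q e : pairing (p + q) e = pairing p e + pairing q e.
Proof. by rewrite /pairing -big_split; apply: eq_bigr => l _; rewrite coefD mulrDl. Qed.

Lemma pairingZ k q e : pairing (k *: q) e = k * pairing q e.
Proof. by rewrite /pairing mulr_sumr; apply: eq_bigr => l _; rewrite coefZ mulrA. Qed.

Lemma pairingXn (l : 'I_n) e : pairing 'X^l e = toC (e l ord0).
Proof.
rewrite /pairing (bigD1 l) //= coefXn eqxx mul1r big1 ?addr0 // => m ml.
by rewrite coefXn val_eqE (negPf ml) mul0r.
Qed.

End ShiftPairing.

(** Since [size q < n], the functional ignores the last coordinate, the only one the input drives,
    and ['X * q] still fits into [n] coefficients. *)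
Lemma pairing_shift (R : realType) (n : nat) (q : {poly R[i]}) (e e' : 'cV[R]_n) :
  (size q < n)%N ->
  (forall l l' : 'I_n, l' = l.+1 :> nat -> e' l ord0 = e l' ord0) ->
  pairing q e' = pairing ('X * q) e.
Proof.
case: n e e' => // n e e'; rewrite ltnS => sq sh.
rewrite /pairing big_ord_recr [RHS]big_ord_recl /= (nth_default 0 sq) mul0r addr0.
rewrite coefXM eqxx mul0r add0r; apply: eq_bigr => l _.
by rewrite coefXM /= (sh _ (lift ord0 l)).
Qed.

Lemma coef_bpoly (R : realType) (n : nat) (b : 'I_n.-1 -> R) (l : 'I_n) :
  (bpoly b)`_l = bext b l.+1.
Proof.
rewrite /bpoly coefD coefXn coef_sum /bext.
under eq_bigr => j _ do rewrite coefZ coefXn.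
have n0 : (0 < n)%N by case: n l {b} => [[]|].
have [ln|ln] := eqVneq l.+1 n.
  have -> : (l == n.-1 :> nat) by rewrite -[X in X == _]succnK ln.
  rewrite big1 ?addr0 // => j _; rewrite eqn_leq.
  suff -> : (l <= j)%N = false by rewrite mulr0.
  by apply/negbTE; rewrite -ltnNge (leq_trans (ltn_ord j)) // -[X in (_ <= X)%N]succnK ln.
have -> : (l == n.-1 :> nat) = false.
  by apply/negbTE; apply: contraNneq ln => ->; rewrite prednK.
have lt : (l < n.-1)%N by rewrite -ltnS prednK // ltn_neqAle ln ltn_ord.
rewrite insubT add0r (bigD1 (Ordinal lt)) //= eqxx mulr1 big1 ?addr0 => [|j jl].
  by congr b; apply: val_inj.
case: eqP => [e|]; last by rewrite mulr0.
by case/eqP: jl; apply: val_inj.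
Qed.

Lemma size_bpoly (R : realType) (n : nat) (b : 'I_n.-1 -> R) : (0 < n)%N ->
  size (bpoly b) = n /\ bpoly b \is monic.
Proof.
move=> n0; have s : (size (\sum_(j < n.-1) b j *: 'X^j)%R < size ('X^(n.-1) : {poly R}))%N.
  rewrite size_polyXn ltnS; apply: leq_trans (size_sum _ _ _) _.
  by apply/bigmax_leqP => j _; rewrite (leq_trans (size_scale_leq _ _)) // size_polyXn.
split; first by rewrite /bpoly size_polyDl // size_polyXn prednK.
by rewrite monicE lead_coefDl // lead_coefXn.
Qed.

(** * The cascade of stable first-order filters *)

Section Filter.
Variables (R : realType) (n N : nat) (adj : rel 'I_N).
Variables (a : 'I_n -> R) (b : 'I_n.-1 -> R) (c : 'I_N -> 'I_N -> R).
Variables (sigma beta gamma M : R) (t0 : nat).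
Hypotheses (n_gt0 : (0 < n)%N) (M_gt0 : 0 < M) (gamma_gt0 : 0 < gamma).
Hypotheses (ht0 : gamma * (dmax adj)%:R - 1 < t0%:R).
Hypothesis b_schur : forall z : R[i],
  root (map_poly (real_complex R) (bpoly b)) z -> `|z| < 1.

Local Notation state := (state R n N).
Local Notation bit_step := (bit_step adj a b c sigma beta gamma M).
Local Notation transition := (transition adj a b c sigma beta gamma M t0).
Local Notation expect := (expect adj a b c sigma beta gamma M t0).
Local Notation bounded_state := (bounded_state adj b M).
Local Notation consensus_error := (consensus_error b).
Local Notation toC := (real_complex R).

Definition deviation (i : 'I_N) (st : state) : 'cV[R]_n := st.1 i - xbar st.1.

Lemma bit_step_shift t st sb i (l l' : 'I_n) : l' = l.+1 :> nat ->
  (bit_step t st sb).1 i l ord0 = st.1 i l' ord0.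
Proof.
move=> ll'; have ln : (l.+1 < n)%N by rewrite -ll' ltn_ord.
rewrite /= mxE [((_ *: _) : 'cV_n) _ _]mxE [Bvec _ _ _ _]mxE (ltn_eqF ln) mulr0 addr0.
rewrite mxE (bigD1 l') //= mxE ln ll' eqxx mul1r big1 ?addr0 // => m ml.
by rewrite mxE ln -ll' val_eqE (negPf ml) mul0r.
Qed.

Lemma deviation_bit_step t st sb i (l l' : 'I_n) : l' = l.+1 :> nat ->
  deviation i (bit_step t st sb) l ord0 = deviation i st l' ord0.
Proof.
move=> ll'; rewrite /deviation /xbar ![(_ - _ : 'cV_n) _ _]mxE.
rewrite ![(- _ : 'cV_n) _ _]mxE ![(_ *: _ : 'cV_n) _ _]mxE !summxE.
rewrite (bit_step_shift _ _ _ _ ll'); congr (_ - _ * _).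
by apply: eq_bigr => j _; exact: bit_step_shift ll'.
Qed.

Lemma pairing_bpoly i st : pairing (map_poly toC (bpoly b)) (deviation i st) =
  toC (consensus_error st i ord0).
Proof.
rewrite /pairing; under eq_bigr => l _ do rewrite coef_map coef_bpoly -rmorphM.
rewrite -rmorph_sum; congr toC.
rewrite /consensus_error JN_mulE mxE /deviation /xbar.
transitivity (sc (K2 b *m (st.1 i - N%:R^-1 *: \sum_j st.1 j))).
  by rewrite /sc [RHS]mxE; apply: eq_bigr => l _; rewrite [K2 b _ _]mxE.
rewrite mulmxBr -scalemxAr mulmx_sumr /sc mxE; congr (_ + _).
rewrite mxE [((_ *: _) : 'M[R]_(1, 1)) _ _]mxE summxE; congr (- _); congr (_ * _).
by apply: eq_bigr => j _; rewrite [RHS]mxE.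
Qed.

Variables (S : (nat -> R) -> Prop) (Srate : rate_class S).
Variables (st0 : state) (bst0 : bounded_state st0) (i : 'I_N).

Definition small (q : {poly R[i]}) : Prop :=
  S (fun k => expect k 0 st0 (fun s => csq (pairing q (deviation i s)))).

Lemma expect_ge0 k (phi : state -> R) : (forall s, 0 <= phi s) -> 0 <= expect k 0 st0 phi.
Proof.
move=> phi0; rewrite -(expect_cst adj a b c sigma beta gamma M t0 k 0 st0 0).
by apply: (@expect_le _ _ _ _ _ _ _ _ _ _ M).
Qed.

Lemma smallD p q : small p -> small q -> small (p + q).
Proof.
move=> sp sq; apply: (@rate_dom _ _ Srate _ _ 2 _ _ (rate_add Srate sp sq)) => // k.
rewrite expect_ge0 /=; last by move=> s; exact: csq_ge0.
rewrite mulrDr -expect_lin; apply: (@expect_le _ _ _ _ _ _ _ _ _ _ M) => // s _.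
by rewrite pairingD; have := csqD_le (pairing p (deviation i s)) (pairing q (deviation i s)) ltr01;
  rewrite invr1.
Qed.

Lemma smallZ x q : small q -> small (x *: q).
Proof.
move=> sq; apply: (@rate_dom _ _ Srate _ _ (csq x) _ _ sq); first exact: csq_ge0.
move=> k; rewrite expect_ge0 /=; last by move=> s; exact: csq_ge0.
rewrite -[leRHS]addr0 -(mul0r (expect k 0 st0 (fun=> 0))) -expect_lin.
apply: (@expect_le _ _ _ _ _ _ _ _ _ _ M) => // s _.
by rewrite pairingZ csqM mul0r addr0.
Qed.

(* Along the dynamics [pairing q] becomes [pairing ('X * q)], so
   [pairing h] is a first-order filter of [pairing (h * ('X - z))]. *)
Lemma small_filter (h : {poly R[i]}) (z : R[i]) : `|z| < 1 -> (size h < n)%N ->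
  small (h * ('X - z%:P)) -> small h.
Proof.
move=> /csq_lt1 z1 sh sm; have z0 := csq_ge0 z.
pose t := (1 - csq z) / 2; have t_gt0 : 0 < t by rewrite divr_gt0 // subr_gt0.
have r01 : 0 <= (1 + t) * csq z < 1 by rewrite /t; apply/andP; split; nra.
have C0 : 0 <= 1 + t^-1 by rewrite addr_ge0 // invr_ge0 ltW.
apply: (rate_filter Srate r01 C0 _ _ sm) => k.
  by apply: expect_ge0 => s; exact: csq_ge0.
rewrite expectSr add0n -expect_lin; apply: (@expect_le _ _ _ _ _ _ _ _ _ _ M) => // s _.
have e sb : pairing h (deviation i (bit_step (t0 + k).+1 s sb)) =
    z * pairing h (deviation i s) + pairing (h * ('X - z%:P)) (deviation i s).
  rewrite (pairing_shift sh (fun l l' => @deviation_bit_step (t0 + k).+1 s sb i l l')).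
  rewrite -pairingZ -pairingD; congr pairing.
  by rewrite mulrBr [h * z%:P]mulrC mul_polyC addrC subrK mulrC.
rewrite /transition; under eq_bigr => sb _ do rewrite e.
rewrite -mulr_suml sum_bits_prob mul1r.
by apply: le_trans (csqD_le _ _ t_gt0) _; rewrite csqM mulrA.
Qed.

(** Removes the root factors one at a time. The filter makes [h] small once [h * ('X - z)] is;
    dividing [q] by ['X - z] writes [q * h] as a multiple of [h * ('X - z)] plus a scalar multiple
    of [h]. *)
Lemma small_all (rs : seq R[i]) (h : {poly R[i]}) : h \is monic -> all (fun z => `|z| < 1) rs ->
  (size (h * \prod_(z <- rs) ('X - z%:P))%R <= n)%N ->
  (forall q, (size (q * (h * \prod_(z <- rs) ('X - z%:P)))%R <= n)%N ->
     small (q * (h * \prod_(z <- rs) ('X - z%:P)))) ->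
  forall q, (size (q * h)%R <= n)%N -> small (q * h).
Proof.
elim: rs h => [|z rs IH] h hm /=; first by rewrite big_nil mulr1.
case/andP => z1 rs1; rewrite big_cons !mulrA => sz sm q sq.
have hzm : h * ('X - z%:P) \is monic by rewrite monicMl ?monicXsubC.
have {}IH := IH _ hzm rs1 sz.
have IH' p : (size (p * (h * ('X - z%:P)))%R <= n)%N -> small (p * (h * ('X - z%:P))).
  by apply: IH => r; rewrite !mulrA; move: (sm r); rewrite !mulrA.
have shz : (size (h * ('X - z%:P))%R <= n)%N.
  apply: leq_trans sz; rewrite [leqRHS]size_monicM ?monic_neq0 ?monic_prod_XsubC //.
  by rewrite size_prod_XsubC /= addnS /= leq_addr.
have sh : (size h < n)%N.
  by move: shz; rewrite size_monicM ?polyXsubC_eq0 // size_XsubC addn2.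
have smh : small h.
  by apply: small_filter z1 sh _; rewrite -[h * _]mul1r; apply: IH'; rewrite mul1r.
rewrite (divp_eq q ('X - z%:P)).
have : (size (q %% ('X - z%:P))%R <= 1)%N.
  by have := ltn_modp q ('X - z%:P); rewrite polyXsubC_eq0 size_XsubC ltnS.
move=> /size1_polyC ->; rewrite mulrDl mul_polyC; apply: smallD; last exact: smallZ.
rewrite -mulrA [_ * h]mulrC; apply: IH'.
have [->|q0] := eqVneq (q %/ ('X - z%:P)) 0; first by rewrite mul0r size_poly0.
have qz : q != 0 by apply: contraNneq q0 => ->; rewrite div0p.
apply: leq_trans sq.
have sq' : size q = (size (q %/ ('X - z%:P))%R).+1.
  by rewrite size_divp ?polyXsubC_eq0 // size_XsubC subn1 prednK ?size_poly_gt0.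
have h0 : h != 0 by exact: monic_neq0.
rewrite [leqRHS]size_mul // sq' size_mul ?mulf_neq0 ?polyXsubC_eq0 //.
by rewrite size_mul ?polyXsubC_eq0 // size_XsubC addn2 addnS addSn.
Qed.

Lemma rate_deviation :
  S (fun k => expect k 0 st0 (fun s => sqnorm (consensus_error s))) ->
  S (fun k => expect k 0 st0 (fun s => sqnorm (deviation i s))).
Proof.
move=> hS; have [sb mb] := size_bpoly b n_gt0.
set p := map_poly toC (bpoly b).
have sp : size p = n by rewrite size_map_poly.
have pm : p \is monic by rewrite map_monic.
have small_p : small p.
  apply: (@rate_dom _ _ Srate _ _ 1 _ _ hS) => // k.
  rewrite expect_ge0 /=; last by move=> s; exact: csq_ge0.
  rewrite mul1r; apply: (@expect_le _ _ _ _ _ _ _ _ _ _ M) => // s _.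
  by rewrite pairing_bpoly csq_real sqr_le_sqnorm.
have [rs pE] := closed_field_poly_normal p.
rewrite (monicP pm) scale1r in pE.
have rs1 : all (fun z => `|z| < 1) rs.
  by apply/allP => z zrs; apply: b_schur; rewrite -/p pE root_prod_XsubC.
(* The descent starts at [p], whose multiples of size at most [n] are scalar ones, and ends at the
   divisor 1, hence at every [q]. *)
have small_q (q : {poly R[i]}) : (size q <= n)%N -> small q.
  rewrite -[q]mulr1; apply: (small_all (monic1 _) rs1) => [|r]; rewrite mul1r -pE ?sp //.
  have [->|r0] := eqVneq r 0.
    by move=> _; rewrite mul0r -(scale0r p); exact: smallZ.
  rewrite size_mul ?(monic_neq0 pm) // sp => szr.
  have /size1_polyC -> : (size r <= 1)%N.
    move: szr; case: (size r) => // m; rewrite addSn /= -[X in (_ <= X)%N]add0n.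
    by rewrite leq_add2r leqn0 => /eqP ->.
  by rewrite mul_polyC; exact: smallZ.
have sum_small (r : seq 'I_n) :
    S (fun k => expect k 0 st0 (fun s => \sum_(l <- r) deviation i s l ord0 ^+ 2)).
  elim: r => [|l r IH].
    apply: (@rate_dom _ _ Srate _ _ 0 _ _ hS) => // k.
    have -> : (fun s => \sum_(l <- [::]) deviation i s l ord0 ^+ 2) = (fun=> 0).
      by apply/funext => s; rewrite big_nil.
    by rewrite expect_cst mul0r lexx.
  have sl := small_q 'X^l; rewrite size_polyXn ltn_ord in sl.
  apply: (@rate_dom _ _ Srate _ _ 1 _ _ (rate_add Srate (sl isT) IH)) => // k.
  rewrite expect_ge0 /=; last by move=> s; apply: sumr_ge0 => ? _; exact: sqr_ge0.
  rewrite mulrDr -expect_lin; apply: (@expect_le _ _ _ _ _ _ _ _ _ _ M) => // s _.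
  by rewrite big_cons pairingXn csq_real !mul1r.
exact: sum_small.
Qed.

End Filter.

(** Both parts at once: [theta] is the decay rate to be exceeded, 0 for convergence and 1 for
    O(1/t). The conditions on [p], [q], [r] say that the matrix with diagonal [p], [r] and
    off-diagonal [-q] is positive definite. *)
Lemma consensus_rate (R : realType) (n N : nat) (hn : (2 <= n)%N) (hN : (2 <= N)%N)
  (adj : rel 'I_N) (adj_sym : symmetric adj)
  (adj_conn : forall i j : 'I_N, connect adj i j)
  (l2 : R) (l2_gt0 : 0 < l2)
  (gap : forall v : 'cV[R]_N, \sum_i v i ord0 = 0 ->
     l2 * sqnorm v <= dot v (laplacian R adj *m v))
  (a : 'I_n -> R) (b : 'I_n.-1 -> R)
  (b_schur : forall z : R[i],
      root (map_poly (real_complex R) (bpoly b)) z -> `|z| < 1)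
  (c : 'I_N -> 'I_N -> R) (sigma : R) (sigma_gt0 : 0 < sigma)
  (beta gamma : R) (beta_gt0 : 0 < beta) (gamma_gt0 : 0 < gamma)
  (M : R) (M_gt0 : 0 < M)
  (t0 : nat) (ht0 : gamma * (dmax adj)%:R - 1 < t0%:R)
  (st0 : state R n N) (bst0 : bounded_state adj b M st0)
  (fM : R) (fM_ge0 : 0 <= fM)
  (fM_le : forall i j, adj i j -> fM <= gaussf sigma (`|c i j| + M))
  (theta : R) (i : 'I_N) (S : (nat -> R) -> Prop) :
  let q := gamma * (lambdaG R adj / l2) in
  let p := gamma * l2 - theta in
  let r := 2 * beta * fM - gamma * estimation_rate adj l2 - theta in
  0 < p -> q ^+ 2 < p * r ->
  rate_class S ->
  (forall rho C (u : nat -> R), theta < rho -> 0 <= C -> (forall k, 0 <= u k) ->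
    (forall k, u k.+1 <= (1 - rho / (t0 + 1 + k)%:R) * u k + C / (t0 + 1 + k)%:R ^+ 2) ->
    S u) ->
  S (fun k => expect adj a b c sigma beta gamma M t0 k 0 st0
                (fun s => sqnorm (deviation i s))).
Proof.
move=> q p r p0 qpr Srate lyap.
have n0 : (0 < n)%N by exact: ltnW.
have N0 : (0 < N)%N by exact: ltnW.
have lG0 := @lambdaG_gt0 R N adj hN adj_conn.
have q0 : 0 <= q by rewrite mulr_ge0 ?divr_ge0 // ltW.
have r0 : 0 < r by rewrite -(pmulr_rgt0 _ p0) (le_lt_trans (sqr_ge0 q)).
(* These weights equalize both rows: [p * u - q * v = r * v - q * u = m]. The surplus [m / (u + v)]
   in [rho] is small enough for each row, as [u] and [v] are at most [u + v]. *)
pose u := r + q; pose v := p + q; pose m := p * r - q ^+ 2.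
have u0 : 0 < u by rewrite ltr_wpDr.
have v0 : 0 < v by rewrite ltr_wpDr.
have m0 : 0 < m by rewrite subr_gt0.
pose rho := theta + m / (u + v).
have uv0 : 0 < u + v by rewrite addr_gt0.
have mu : m / (u + v) * u <= m.
  by rewrite mulrAC ler_pdivrMr // ler_pM2l // lerDl ltW.
have mv : m / (u + v) * v <= m.
  by rewrite mulrAC ler_pdivrMr // ler_pM2l // lerDr ltW.
have hu : rho * u <= gamma * l2 * u - q * v.
  apply: le_trans (_ : theta * u + m <= _); first by rewrite /rho mulrDl lerD2l.
  by apply: ler_eq; rewrite /m /u /v /p; ring.
have hv : rho * v <= (2 * beta * fM - gamma * estimation_rate adj l2) * v - q * u.
  apply: le_trans (_ : theta * v + m <= _); first by rewrite /rho mulrDl lerD2l.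
  by apply: ler_eq; rewrite /m /u /v /r; ring.
have [C C0 drift] := lyapunov_drift a b n0 M_gt0 gamma_gt0 ht0 sigma_gt0 beta_gt0
  fM_ge0 fM_le adj_sym N0 l2_gt0 lG0 gap (ltW u0) (ltW v0) hu hv.
have L0 s : 0 <= lyapunov adj b u v s.
  by rewrite addr_ge0 // mulr_ge0 ?sqnorm_ge0 // ltW.
have SU : S (fun k => expect adj a b c sigma beta gamma M t0 k 0 st0 (lyapunov adj b u v)).
  apply: (lyap rho C) => // [|k|k].
  - by rewrite ltrDl divr_gt0.
  - exact: (@expect_ge0 _ _ _ _ _ _ _ _ _ _ M).
  - rewrite expectSr add0n.
    rewrite -[C / _]mulr1 -[X in C / _ * X](expect_cst adj a b c sigma beta gamma M t0 k 0 st0).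
    rewrite -expect_lin; apply: (@expect_le _ _ _ _ _ _ _ _ _ _ M) => // s bs.
    by rewrite mulr1 drift.
apply: (rate_deviation n0 M_gt0 gamma_gt0 ht0 b_schur Srate bst0).
apply: (@rate_dom _ _ Srate _ _ u^-1 _ _ SU); first by rewrite invr_ge0 ltW.
move=> k; apply/andP; split.
  by apply: (@expect_ge0 _ _ _ _ _ _ _ _ _ _ M) => // s; exact: sqnorm_ge0.
rewrite ler_pdivlMl // -[leLHS]addr0.
rewrite -(mul0r (expect adj a b c sigma beta gamma M t0 k 0 st0 (fun=> 0))) -expect_lin.
apply: (@expect_le _ _ _ _ _ _ _ _ _ _ M) => // s _.
by rewrite mulr0 lerD2l mulr_ge0 ?sqnorm_ge0 // ltW.
Qed.

(** Positivity of the infimum follows from one bound valid for all pairs: the density at the sum of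
    all [|c_ij|] plus [M]. *)
Lemma inf_gaussf (R : realType) (N : nat) (adj : rel 'I_N) (c : 'I_N -> 'I_N -> R)
  (sigma M : R) : (exists i j, adj i j) -> 0 < sigma -> 0 < M ->
  let fM := inf [set gaussf sigma (`|c p.1 p.2| + M)
                | p in [set p : 'I_N * 'I_N | adj p.1 p.2]] in
  0 < fM /\ forall i j, adj i j -> fM <= gaussf sigma (`|c i j| + M).
Proof.
move=> [i0 [j0 a0]] s0 M0 fM; split; last first.
  move=> i j aij; apply: ge_inf; last by exists (i, j).
  by exists 0 => _ [p _ <-]; rewrite ltW // gaussf_gt0.
apply: lt_le_trans (gaussf_gt0 s0 (\sum_p `|c p.1 p.2| + M)) _.
apply: lb_le_inf; first by exists (gaussf sigma (`|c i0 j0| + M)), (i0, j0).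
move=> _ [p _ <-]; apply: gaussf_antitone => //.
rewrite ger0_norm; last by rewrite addr_ge0 // ltW.
by rewrite lerD2r (bigD1 p) //= lerDl sumr_ge0.
Qed.

Theorem theorem2
  (R : realType) (n N : nat) (hn : (2 <= n)%N) (hN : (2 <= N)%N)
  (* graph: fixed, undirected (symmetric, no self-loops), connected *)
  (adj : rel 'I_N) (adj_sym : symmetric adj) (adj_irr : irreflexive adj)
  (adj_conn : forall i j : 'I_N, connect adj i j)
  (* eigenvalues of the Laplacian, with multiplicity, in increasing order *)
  (lam : seq R) (lam_size : size lam = N) (lam_sorted : sorted <=%R lam)
  (lam_spec : char_poly (laplacian R adj) = \prod_(x <- lam) ('X - x%:P))
  (* system and gains *)
  (a : 'I_n -> R) (b : 'I_n.-1 -> R)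
  (b_schur : forall z : R[i],
      root (map_poly (real_complex R) (bpoly b)) z -> `|z| < 1)
  (* communication thresholds and noise on a probability space *)
  (c : 'I_N -> 'I_N -> R) (sigma : R) (sigma_gt0 : 0 < sigma)
  (dT : measure_display) (T : measurableType dT) (P : probability T R)
  (d : 'I_N -> 'I_N -> nat -> T -> R)
  (d_meas : forall i j t, adj i j -> measurable_fun setT (d i j t))
  (d_law : forall i j t, adj i j -> forall B : set R, measurable B ->
      P (d i j t @^-1` B) = normal_prob 0 sigma B)
  (d_indep : mutually_independent P
      (fun p : 'I_N * 'I_N * nat => adj p.1.1 p.1.2)
      (fun p => d p.1.1 p.1.2 p.2))
  (* algorithm parameters and initial data *)
  (beta gamma : R) (beta_gt0 : 0 < beta) (gamma_gt0 : 0 < gamma)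
  (t0 : nat) (ht0 : gamma * (dmax adj)%:R - 1 < t0%:R)
  (x0 : 'I_N -> 'cV[R]_n) (z0 : 'I_N -> 'I_N -> R) (M : R) (M_gt0 : 0 < M)
  (hx0 : forall i, `|sc (K2 b *m x0 i)| <= M)
  (hz0 : forall i j, adj i j -> `|z0 i j| <= M) :
  let lambda2 := lam`_1 in
  let lG := lambdaG R adj in
  let alpha := 2 * Num.sqrt (lambdaQW R adj)
               + lambdaQL R adj * lambda2 / lG in
  let fM := inf [set gaussf sigma (`|c p.1 p.2| + M)
                 | p in [set p : 'I_N * 'I_N | adj p.1 p.2]] in
  (* x_i(t0+1+k) for the noise realization w *)
  let x k w := (traj adj a b c sigma beta gamma M t0 x0 z0 d k w).1 in
  let err i k := (\int[P]_w (sqnorm (x k w i - xbar (x k w)))%:E)%E in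
  (beta > (2 * fM)^-1 * (gamma * lG ^+ 2 / lambda2 ^+ 3 + gamma * alpha) ->
     forall i, err i k @[k --> \oo] --> 0%E)
  /\
  (gamma > lambda2^-1 ->
   beta > (2 * fM)^-1 * (gamma ^+ 2 * lG ^+ 2
                          / (lambda2 ^+ 2 * (gamma * lambda2 - 1))
                         + gamma * alpha + 1) ->
     forall i, exists C : R, forall k,
       (err i k <= (C / (t0 + 1 + k)%:R)%:E)%E).
Proof.
move=> lambda2 lG alpha fM x err.
have [l2_gt0 gap] := laplacian_spectral_gap adj_sym adj_conn hN lam_size lam_sorted lam_spec.
have lG0 : 0 < lG := @lambdaG_gt0 R N adj hN adj_conn.
have [fM0 fM_le] := inf_gaussf c (connected_has_edge hN adj_conn) sigma_gt0 M_gt0; rewrite -/fM in fM0 fM_le.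
have bst0 : bounded_state adj b M (x0, z0) by split.
have errE i k : err i k = (expect adj a b c sigma beta gamma M t0 k 0 (x0, z0)
    (fun s => sqnorm (deviation i s)))%:E.
  rewrite -(integral_traj a b c beta gamma M t0 d_meas d_law d_indep) //.
  by move=> s; exact: sqnorm_ge0.
have rate := consensus_rate hn hN adj_sym adj_conn l2_gt0 gap a b_schur sigma_gt0
  beta_gt0 gamma_gt0 M_gt0 ht0 bst0 (ltW fM0) fM_le.
split.
  rewrite ltr_pdivrMl; last by rewrite mulr_gt0.
  move=> hb i; have p0 : 0 < gamma * lambda2 - 0 by rewrite subr0 mulr_gt0.
  (* With [theta = 0], dividing [q ^+ 2 < p * r] by [p = gamma * lambda2] gives back the hypothesis
     on [beta]. *)
  have qpr : (gamma * (lG / lambda2)) ^+ 2 <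
      (gamma * lambda2 - 0) * (2 * beta * fM - gamma * estimation_rate adj lambda2 - 0).
    rewrite !subr0 -ltr_pdivrMl ?mulr_gt0 //.
    have -> : (gamma * lambda2)^-1 * (gamma * (lG / lambda2)) ^+ 2 =
        gamma * lG ^+ 2 / lambda2 ^+ 3.
      by field; rewrite !gt_eqF.
    by move: hb; rewrite /alpha /estimation_rate -/lambda2 -/lG; lra.
  have := rate 0 i _ p0 qpr (rate_class_cvg0 R).
  move=> /(_ (fun rho C u => @cvg0_of_lyapunov R t0 u rho C)) h.
  have -> : err i = EFin \o (fun k => expect adj a b c sigma beta gamma M t0 k 0 (x0, z0)
      (fun s => sqnorm (deviation i s))) by apply/funext => k; exact: errE.
  by apply/fine_cvgP; split; [exists 0%N|exact: h].
move=> hg; rewrite ltr_pdivrMl; last by rewrite mulr_gt0.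
move=> hb i.
have p0 : 0 < gamma * lambda2 - 1.
  by rewrite subr_gt0 -ltr_pdivrMr // div1r.
(* Now [theta = 1]: it accounts for the summand 1 in the bound on [beta], and [p > 0] is the
   condition on [gamma]. *)
have qpr : (gamma * (lG / lambda2)) ^+ 2 <
    (gamma * lambda2 - 1) * (2 * beta * fM - gamma * estimation_rate adj lambda2 - 1).
  rewrite -ltr_pdivrMl //.
  have -> : (gamma * lambda2 - 1)^-1 * (gamma * (lG / lambda2)) ^+ 2 =
      gamma ^+ 2 * lG ^+ 2 / (lambda2 ^+ 2 * (gamma * lambda2 - 1)).
    by field; rewrite !gt_eqF.
  by move: hb; rewrite /alpha /estimation_rate -/lambda2 -/lG; lra.
have := rate 1 i _ p0 qpr (rate_class_bigO R t0).
move=> /(_ (fun rho C u => @bigO_of_lyapunov R t0 u rho C)) [C C0 h].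
by exists C => k; rewrite errE lee_fin.
Qed.
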